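(* Let $d\ge1$, $\delta_0\in(0,1]$, $\gamma\in(0,1)$, $r\in[1,d/(d-\delta_0(1-\gamma)))$, and let $\pi$ be a nonnegative definite tempered measure on $\mathbb R^d$. Put $\alpha_{\delta_0,\gamma,r}:=d-r(d-\delta_0(1-\gamma))\in(0,d)$. The following are equivalent: (i) $\int_{|x|<1}|x|^{2\alpha_{\delta_0,\gamma,r}-d}\pi(\mathrm dx)<\infty$ in the case $0<\alpha_{\delta_0,\gamma,r}<d/2$; $\int_{|x|<1}\log(1/|x|)\pi(\mathrm dx)<\infty$ in the case $\alpha_{\delta_0,\gamma,r}=d/2$; no condition in the case $\alpha_{\delta_0,\gamma,r}>d/2$. (ii) $R^r_{\delta_0(1-\gamma)}*R^r_{\delta_0(1-\gamma)}\in L_1(\mathbb R^d,\pi)$, i.e. $$\nu_{\delta_0,\gamma,r}:=\int_{\mathbb R^d}(R^r_{\delta_0(1-\gamma)}*R^r_{\delta_0(1-\gamma)})(x)\,\pi(\mathrm dx)<\infty .$$ (iii) $R^r_{\delta_0(1-\gamma)}*R^r_{\delta_0(1-\gamma)}\in L_1(B_1(0),\pi)$, i.e. $$\int_{|x|<1}(R^r_{\delta_0(1-\gamma)}*R^r_{\delta_0(1-\gamma)})(x)\,\pi(\mathrm dx)<\infty .$$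
   Context: A tempered measure is a nonnegative Borel measure $\pi$ on $\mathbb R^d$ with $\int_{\mathbb R^d}(1+|x|^2)^{-k/2}\pi(\mathrm dx)<\infty$ for some $k\ge0$. It is nonnegative definite if $(\pi,\psi*\overline{\tilde\psi})\ge0$ for every Schwartz $\psi$, $\tilde\psi(x)=\psi(-x)$. For $\beta>0$, $R_\beta(x):=\frac1{(2\pi)^{d/2}}\int_{\mathbb R^d}\frac{e^{\mathrm i x\cdot\xi}}{(1+|\xi|^2)^{\beta/2}}\mathrm d\xi$ (the Bessel potential kernel, a strictly positive function, the integral being understood as an inverse Fourier transform), and $R_\beta^r$ denotes its pointwise $r$-th power. Integrands are read as $+\infty$ at $x=0$ when singular there. *)

(* Defs.v *)
From HB Require Import structures.
From mathcomp Require Import all_boot all_order all_algebra.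
From mathcomp Require Import all_classical all_reals all_analysis.
From mathcomp Require Import measurable_realfun complex.

Set Implicit Arguments.
Unset Strict Implicit.
Unset Printing Implicit Defensive.

Import Order.TTheory GRing.Theory Num.Theory.
Import numFieldNormedType.Exports.

Local Open Scope classical_set_scope.
Local Open Scope ring_scope.

(* R^d is 'rV[R]_d, with the Borel sigma-algebra of its (product) topology. *)
Definition rV_borel_display : measure_display. Proof. exact: default_measure_display. Qed.

Section borel_rV.
Variables (R : realType) (n : nat).

Definition borel_rV : set (set 'rV[R]_n) := <<s open >>.

Let borel_rV0 : borel_rV set0.
Proof. exact: sigma_algebra0. Qed.

Let borel_rVC A : borel_rV A -> borel_rV (~` A).
Proof. exact: sigma_algebraC. Qed.

Let borel_rV_bigcup (F : (set 'rV[R]_n)^nat) :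
  (forall i, borel_rV (F i)) -> borel_rV (\bigcup_i F i).
Proof. exact: sigma_algebra_bigcup. Qed.

HB.instance Definition _ := @isMeasurable.Build rV_borel_display
  'rV[R]_n borel_rV borel_rV0 borel_rVC borel_rV_bigcup.

End borel_rV.

Definition rat_rV (R : realType) (n : nat) (q : 'rV[rat]_n) : 'rV[R]_n :=
  map_mx ratr q.

Lemma open_rV_bigcup_ball (R : realType) (n : nat) (U : set 'rV[R]_n) :
  open U ->
  U = \bigcup_(p : 'rV[rat]_n * nat) [set x | ball (rat_rV R p.1) p.2.+1%:R^-1 x /\
        ball (rat_rV R p.1) p.2.+1%:R^-1 `<=` U].
Proof.
move=> oU; apply/seteqP; split => [x Ux|x [p _ [xp]]]; last exact.
have [e /= e0 xeU] : exists2 e : R, 0 < e & ball x e `<=` U.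
  by have /nbhs_ballP[e e0 xeU] := open_nbhs_nbhs (conj oU Ux); exists e.
have [k ke] : exists k, k.+1%:R^-1 < e / 2 :> R.
  have e20 : 0 < e / 2 by rewrite divr_gt0.
  by have [k _ /(_ k (leqnn k))] := near_infty_natSinv_lt (PosNum e20); exists k.
have k0 : 0 < k.+1%:R^-1 :> R by rewrite invr_gt0.
have /choice[q xq] i : exists q : rat, `|x ord0 i - ratr q| < k.+1%:R^-1.
  have /rat_in_itvoo[q] : x ord0 i - k.+1%:R^-1 < x ord0 i + k.+1%:R^-1.
    by rewrite ltrBlDr -addrA ltrDl addr_gt0.
  by rewrite in_itv/= -ltr_distl distrC => xq; exists q.
have bx : ball (rat_rV R (\row_i q i)) k.+1%:R^-1 x.
  by split => // i j; rewrite (ord1 i) !mxE -ball_normE /= distrC.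
exists (\row_i q i, k) => //; split => //= y yq; apply: xeU.
rewrite [e](splitr e).
apply: (@ball_triangle _ _ (rat_rV R (\row_i q i))).
  by apply: ball_sym; apply: le_ball bx; exact: ltW.
by apply: le_ball yq; exact: ltW.
Qed.

Lemma measurable_fun_rV (R : realType) (n : nat) (dT : measure_display)
    (T : measurableType dT) (f : T -> 'rV[R]_n) :
  (forall i, measurable_fun [set: T] (fun x => f x ord0 i)) ->
  measurable_fun [set: T] f.
Proof.
move=> mf.
have mball (x : 'rV[R]_n) (e : R) : 0 < e -> measurable (f @^-1` ball x e).
  move=> e0; rewrite (_ : _ @^-1` _ =
      \bigcap_(i : 'I_n) [set t | `|x ord0 i - f t ord0 i| < e]).
    rewrite -[X in measurable X]setCK setC_bigcap; apply: measurableC.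
    apply: countable_bigcupT_measurable => // i; apply: measurableC.
    have := mf i measurableT `]x ord0 i - e, x ord0 i + e[%classic
      (measurable_itv _).
    rewrite setTI; congr measurable; apply/seteqP; split => t /=.
      by rewrite in_itv/= -ltr_distl distrC.
    by rewrite in_itv/= -ltr_distl distrC.
  apply/seteqP; split => t /=; first by move=> [_ h] i _; exact: h.
  by move=> h; split=> // i j; rewrite (ord1 i); exact: h.
apply: (@measurability _ _ T 'rV[R]_n setT f (@open 'rV[R]_n)).
  by [].
move=> _ [U oU <-]; rewrite setTI (open_rV_bigcup_ball oU) preimage_bigcup.
apply: countable_bigcupT_measurable => // -[q k] /=.
have [qU|qU] := pselect (ball (rat_rV R q) k.+1%:R^-1 `<=` U).
  rewrite (_ : _ @^-1` _ = f @^-1` ball (rat_rV R q) k.+1%:R^-1).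
    by apply: mball; rewrite invr_gt0.
  by apply/seteqP; split => t /=; [case|].
rewrite (_ : _ @^-1` _ = set0) ?measurable0//.
by apply/seteqP; split => t //= -[].
Qed.

Definition cons_rV (R : realType) (n : nat) (p : R * 'rV[R]_n) : 'rV[R]_n.+1 :=
  row_mx p.1%:M p.2.

Lemma measurable_coord_rV (R : realType) (n : nat) (i : 'I_n) :
  measurable_fun [set: 'rV[R]_n] (fun x : 'rV[R]_n => x ord0 i).
Proof.
apply: (@measurability _ _ _ _ _ _ (@RGenOpens.G R)).
  exact: RGenOpens.measurableE.
move=> _ [_ [a [b ->]] <-]; rewrite setTI.
apply: sub_sigma_algebra; apply: open_comp; last exact: interval_open.
by move=> x _; exact: coord_continuous.
Qed.

Lemma measurable_cons_rV (R : realType) (n : nat) :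
  measurable_fun [set: R * 'rV[R]_n] (@cons_rV R n).
Proof.
apply: measurable_fun_rV => i.
rewrite /cons_rV; case: (splitP (i : 'I_(1 + n))) => j ij.
  rewrite (_ : (fun _ => _) = fst) //.
  apply/funext => -[t v] /=; rewrite mxE; case: splitP => k ik.
    by rewrite !mxE !ord1 eqxx mulr1n.
  by have := ltn_ord j; rewrite -ij ik ltnNge leq_addr.
rewrite (_ : (fun _ => _) = (fun x : 'rV[R]_n => x ord0 j) \o snd).
  by apply: measurableT_comp => //; exact: measurable_coord_rV.
apply/funext => -[t v] /=; rewrite mxE; case: splitP => k ik.
  by have := ltn_ord k; rewrite -ik ij ltnNge leq_addr.
by congr (v _ _); apply/val_inj; apply/eqP; rewrite -(eqn_add2l 1) -ik ij.
Qed.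

Definition lebesgue_succ (R : realType) (n : nat)
    (mu : {measure set 'rV[R]_n -> \bar R}) : {measure set 'rV[R]_n.+1 -> \bar R} :=
  measure_function_pushforward__canonical__measure_function_Measure
    (lebesgue_measure \x^ mu)%E (@measurable_cons_rV R n).

(* Lebesgue measure on R^n: R^0 carries the unit mass, and R^n.+1 = R x R^n the
   product measure. *)
Fixpoint lebesgue_rV (R : realType) (n : nat) :
    {measure set 'rV[R]_n -> \bar R} :=
  if n is m.+1 return {measure set 'rV[R]_n -> \bar R} then
    lebesgue_succ (lebesgue_rV R m)
  else [the measure _ _ of \d_(0 : 'rV[R]_0)].

Section schwartz.
Variables (R : realType) (d : nat).
Implicit Types (x y xi : 'rV[R]_d) (psi phi : 'rV[R]_d -> R[i]).

Definition dotp x y : R := \sum_(i < d) x ord0 i * y ord0 i.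

(* Euclidean norm; the library norm `|x| on 'rV[R]_d is the sup norm. *)
Definition enorm x : R := Num.sqrt (dotp x x).

Definition unit_ball : set 'rV[R]_d := [set x | enorm x < 1].

Definition partial (i : 'I_d) (f : 'rV[R]_d -> R) : 'rV[R]_d -> R :=
  fun x => 'D_(delta_mx ord0 i) f x.

Definition partials (s : seq 'I_d) (f : 'rV[R]_d -> R) : 'rV[R]_d -> R :=
  foldr partial f s.

(* Bounded partial derivatives of every order force continuity, so the
   two conditions together also say that f is smooth. *)
Definition schwartz_real (f : 'rV[R]_d -> R) : Prop :=
  (forall s i x, derivable (partials s f) x (delta_mx ord0 i)) /\
  (forall s (k : nat), exists C : R,
     forall x, (1 + enorm x) ^+ k * `|partials s f x| <= C).

Definition schwartz psi : Prop :=
  schwartz_real (fun x => complex.Re (psi x)) /\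
  schwartz_real (fun x => complex.Im (psi x)).

Definition cintegral (mu : {measure set 'rV[R]_d -> \bar R}) psi : R[i] :=
  (Rintegral mu setT (fun x => complex.Re (psi x)) +i*
   Rintegral mu setT (fun x => complex.Im (psi x)))%C.

Definition cconv psi phi : 'rV[R]_d -> R[i] :=
  fun x => cintegral (lebesgue_rV R d) (fun y => psi (x - y) * phi y).

Definition tempered (mu : {measure set 'rV[R]_d -> \bar R}) : Prop :=
  exists k : R, 0 <= k /\
    (\int[mu]_x ((1 + enorm x ^+ 2) `^ (- (k / 2)))%:E < +oo)%E.

(* In R[i], 0 <= z means that z is real and nonnegative. *)
Definition nonneg_definite (mu : {measure set 'rV[R]_d -> \bar R}) : Prop :=
  forall psi, schwartz psi ->
    0 <= cintegral mu (cconv psi (fun x => conjc (psi (- x)))).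

Definition expi (t : R) : R[i] := (cos t +i* sin t)%C.

Definition inv_fourier phi : 'rV[R]_d -> R[i] := fun xi =>
  (((2 * pi) `^ (d%:R / 2))^-1)%:C%C *
  cintegral (lebesgue_rV R d) (fun x => expi (dotp x xi) * phi x).

Definition bessel_symbol (beta : R) xi : R :=
  (1 + enorm xi ^+ 2) `^ (- (beta / 2)).

(* K = R_beta: K is a tempered function which, as a distribution, is the inverse
   Fourier transform of the symbol: <K, phi> = <symbol, inv_fourier phi>. This
   determines K almost everywhere; continuity as an extended-real valued
   function selects the usual representative, finite off the origin and, for
   beta <= d, equal to +oo at the origin. *)
Definition is_bessel_kernel (beta : R) (K : 'rV[R]_d -> \bar R) : Prop :=
  [/\ continuous K,
      exists k : R, 0 <= k /\
        (\int[lebesgue_rV R d]_x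
           (`|K x| * ((1 + enorm x ^+ 2) `^ (- (k / 2)))%:E) < +oo)%E
    & forall phi, schwartz phi ->
        cintegral (lebesgue_rV R d) (fun x => (fine (K x))%:C%C * phi x) =
        cintegral (lebesgue_rV R d)
          (fun xi => (bessel_symbol beta xi)%:C%C * inv_fourier phi xi)].

Definition econv (f g : 'rV[R]_d -> \bar R) : 'rV[R]_d -> \bar R :=
  fun x => (\int[lebesgue_rV R d]_y (f (x - y)%R * g y))%E.

Definition alpha_exponent (delta0 gamma r : R) : R :=
  d%:R - r * (d%:R - delta0 * (1 - gamma)).

(* |x|^a and log (1/|x|), read as +oo at the origin; power_at0 is meant for a < 0,
   the library's 0 `^ a and ln (1 / 0) being 0. *)
Definition power_at0 (a : R) x : \bar R :=
  if x == 0 then +oo%E else (enorm x `^ a)%:E.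

Definition log_at0 x : \bar R :=
  if x == 0 then +oo%E else (ln (1 / enorm x))%:E.

Definition singularity_condition (alpha : R)
    (mu : {measure set 'rV[R]_d -> \bar R}) : Prop :=
  (0 < alpha < d%:R / 2 ->
     (\int[mu]_(x in unit_ball) power_at0 (2 * alpha - d%:R) x < +oo)%E) /\
  (alpha = d%:R / 2 ->
     (\int[mu]_(x in unit_ball) log_at0 x < +oo)%E).

End schwartz.

(* Main.v *)
Require Import Defs.
From HB Require Import structures.
From mathcomp Require Import all_boot all_order all_algebra.
From mathcomp Require Import all_classical all_reals all_analysis.
From mathcomp Require Import measurable_realfun complex ring lra.

(** The kernel [K] is a mixture of Gaussians. In the variable [t = expR u] the
    heat kernel is [heat u x = t^(-n/2) exp(-|x|^2/(4t))], and
    [bessel a m x] integrates it against [t^(a/2) exp(-m t) dt/t]; up to a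
    constant this is the kernel of order [a] with symbol
    [(m + |xi|^2)^(-a/2)], because
    [Gamma(b/2) (1 + |xi|^2)^(-b/2)] is the integral of
    [t^(b/2) exp(-(1 + |xi|^2) t) dt/t]. To see that [K] itself equals
    [bessel_const b * bessel b 1], its defining identity is tested on the
    Gaussians centred at [y], whose Fourier transforms are explicit
    ([gauss_fourier]); this gives [bessel_kernel_pairing]. Shrinking the
    width of the Gaussians, the two sides converge to [K y] and to the claimed
    value, first for [y != 0] and then at the origin, where both sides are
    infinite ([bessel_kernelE]).

    The radial profile of [bessel a m] is the integral [macdonald], for which
    crude bounds on the exponent are enough: below the critical order it lies
    between two constant multiples of [|x|^(a-n)] times decaying exponentials,
    at the critical order [a = n] it behaves as [log(1/|x|)] near the origin,
    above it is bounded, and it always decays exponentially.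
    With [alpha - n = r (b - n)] these bounds show that [K^r] is squeezed
    between multiples of [bessel alpha] for two different masses
    ([bessel_power_bounds]); only the behaviour at the origin and the existence
    of some exponential decay matter, so different masses do no harm.

    Convolution is then exact rather than estimated: heat kernels convolve by
    adding times ([heat_conv]), and the resulting double mixture collapses
    ([beta_mixture]), so that [bessel a m] convolved with itself is a constant
    multiple of [bessel (2 * a) m] ([bessel_conv]). Hence [K^r * K^r] is
    squeezed between multiples of kernels of order [2 * alpha]
    ([econv_bessel_bounds]). Off the unit ball these decay exponentially and a
    tempered measure integrates them, which gives the equivalence of global
    and local integrability; on the unit ball they have the singularity
    [|x|^(2 alpha - n)], [log(1/|x|)] or none, according to the position of
    [2 * alpha] with respect to [n], which is the stated condition on the
    measure ([bessel_comparable_equiv]). *)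

Import Order.TTheory GRing.Theory Num.Theory.
Import numFieldNormedType.Exports.

Local Open Scope classical_set_scope.
Local Open Scope ring_scope.

Set Implicit Arguments.
Unset Strict Implicit.
Unset Printing Implicit Defensive.

(** * Integration on the line *)

Lemma lebesgue_tonelli (R : realType) d (T : measurableType d)
  (m : {sigma_finite_measure set T -> \bar R}) (f : R * T -> \bar R) :
  measurable_fun [set: R * T] f -> (forall x, 0 <= f x)%E ->
  (\int[@lebesgue_measure R]_x \int[m]_y f (x, y) =
   \int[m]_y \int[@lebesgue_measure R]_x f (x, y))%E.
Proof.
move=> mf f0.
exact: (@fubini_tonelli _ _ (measurableTypeR R) T R (@lebesgue_measure R) m f mf f0).
Qed.

Lemma lebesgue_tonelli_plane (R : realType) (f : R * R -> \bar R) :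
  measurable_fun [set: R * R] f -> (forall x, 0 <= f x)%E ->
  (\int[@lebesgue_measure R]_x \int[@lebesgue_measure R]_y f (x, y) =
   \int[@lebesgue_measure R]_y \int[@lebesgue_measure R]_x f (x, y))%E.
Proof.
move=> mf f0.
exact: (@fubini_tonelli _ _ (measurableTypeR R) (measurableTypeR R) R
  (@lebesgue_measure R) (@lebesgue_measure R) f mf f0).
Qed.

Section line.
Context {R : realType}.
Local Notation leb := (@lebesgue_measure R).

Lemma ge0_integral_shift (a : R) (f : R -> \bar R) :
  measurable_fun [set: R] f -> (forall x, 0 <= f x)%E ->
  (\int[leb]_x f (x + a)%R = \int[leb]_x f x)%E.
Proof.
move=> mf f0.
have ms : measurable_fun [set: R] (fun x : R => x + a : measurableTypeR R).
  exact: measurable_funD.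
have leb_shift : forall A, measurable A -> leb A = pushforward leb
    (fun x : R => x + a : measurableTypeR R) A.
  apply: (@lebesgue_measure_unique R
    (measure_function_pushforward__canonical__measure_function_Measure leb ms)).
  move=> _ [[x y] _ <-] /=; rewrite /pushforward.
  rewrite (_ : _ @^-1` _ = `]x - a, y - a]%classic); last first.
    by apply/seteqP; split => z /=; rewrite !in_itv/= ltrBlDr lerBrDr.
  rewrite !lebesgue_measure_itv/= !lte_fin ltrD2r.
  by case: ifP => // _; congr EFin; ring.
rewrite [RHS](eq_measure_integral (pushforward leb
    (fun x : R => x + a : measurableTypeR R))); last first.
  by move=> A mA _; exact: leb_shift.
by rewrite ge0_integral_pushforward// preimage_setT.
Qed.

Lemma integral_expRN_norm_lty (q : R) : 0 < q ->
  (\int[leb]_u (expR (- q * `|u|))%:E < +oo)%E.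
Proof.
move=> q0.
have cf : continuous (fun u : R => expR (- q * `|u|)).
  move=> u; apply: (continuous_comp (f := fun u : R => - q * `|u|)).
    by apply: cvgM; [exact: cvg_cst|exact: norm_continuous].
  exact: continuous_expR.
rewrite ge0_symfun_integralT//; last by move=> u /=; rewrite normrN.
apply: lte_mul_pinfty => //.
have -> : (\int[leb]_(x in [set x | (0 <= x)%R]) (expR (- q * `|x|))%:E =
    \int[leb]_(x in [set x | (0 <= x)%R]) (q^-1 * exponential_pdf q x)%:E)%E.
  apply: eq_integral => u; rewrite inE /= => u0.
  by rewrite exponential_pdfE// mulKf ?gt_eqF ?ger0_norm.
apply: (@le_lt_trans _ _ (\int[leb]_u (q^-1 * exponential_pdf q u)%:E)%E).
  apply: ge0_subset_integral => //.
  - by rewrite -set_itvcy.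
  - apply/measurable_EFinP/measurable_funM => //.
    exact: measurable_exponential_pdf.
  - by move=> u _; rewrite lee_fin mulr_ge0 ?invr_ge0 ?exponential_pdf_ge0 ?ltW.
under eq_integral do rewrite EFinM.
rewrite ge0_integralZl_EFin ?integral_exponential_pdf ?mule1 ?ltry//.
- by move=> u _; rewrite lee_fin exponential_pdf_ge0 ?ltW.
- by apply: measurableT_comp => //; exact: measurable_exponential_pdf.
- by rewrite invr_ge0 ltW.
Qed.

Lemma le_expRN_norm_integral_lty (A q : R) (f : R -> R) : 0 < q ->
  measurable_fun [set: R] f -> (forall u, 0 <= f u) ->
  (forall u, f u <= A * expR (- q * `|u|)) ->
  (\int[leb]_u (f u)%:E < +oo)%E.
Proof.
move=> q0 mf f0 fA.
have A0 : 0 <= A.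
  by have := le_trans (f0 0) (fA 0); rewrite pmulr_lge0// expR_gt0.
have me : measurable_fun [set: R] (fun u : R => expR (- q * `|u|)).
  by apply: measurableT_comp => //; apply: measurable_funM.
apply: (@le_lt_trans _ _ (\int[leb]_u (A * expR (- q * `|u|))%:E)%E).
  apply: ge0_le_integral => //.
  - by move=> u _; rewrite lee_fin.
  - exact: measurableT_comp.
  - by apply: measurableT_comp => //; exact: measurable_funM.
  - by move=> u _; rewrite lee_fin.
under eq_integral do rewrite EFinM.
rewrite ge0_integralZl_EFin//; last exact: measurableT_comp.
by rewrite lte_mul_pinfty ?lee_fin ?integral_expRN_norm_lty.
Qed.

Lemma ge_integral_itv (a b c : R) (f : R -> R) : a <= b -> 0 <= c ->
  measurable_fun [set: R] f -> (forall u, 0 <= f u) ->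
  (forall u, a <= u <= b -> c <= f u) ->
  ((c * (b - a))%:E <= \int[leb]_u (f u)%:E)%E.
Proof.
move=> ab c0 mf f0 cf.
apply: (@le_trans _ _ (\int[leb]_(u in `[a, b]) (f u)%:E)%E); last first.
  apply: ge0_subset_integral => //; first exact: measurableT_comp.
  by move=> u _; rewrite lee_fin.
have -> : (c * (b - a))%:E = (\int[leb]_(u in `[a, b]) c%:E)%E.
  rewrite integral_cst//= lebesgue_measure_itv/= lte_fin.
  case: ltP => [_|ba]; first by rewrite EFinM.
  by rewrite mule0 (@le_anti _ _ a b) ?ab// subrr mulr0.
apply: ge0_le_integral => //.
- by apply: measurable_funTS; exact: measurableT_comp.
Qed.

End line.

(** * The Macdonald integral *)

Section macdonald.
Context {R : realType}.
Local Notation leb := (@lebesgue_measure R).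
Implicit Types p m q u v : R.

(** After [t = expR u], the logarithm of [t^p exp(-m t - q/t)]. *)
Definition macdonald_exponent p m q u : R :=
  p * u - m * expR u - q * expR (- u).

(** The integral of [t^p exp(-m t - q/t) dt/t] over the half-line, that is
    [2 (q/m)^(p/2) K_p(2 sqrt(m q))] with the Macdonald function [K_p] when
    [m] and [q] are positive, and a Gamma integral when one of them vanishes.
    On the line, scaling of [t] becomes translation, and all estimates become
    linear inequalities between exponents. *)
Definition macdonald p m q : \bar R :=
  (\int[leb]_u (expR (macdonald_exponent p m q u))%:E)%E.

Lemma measurable_macdonald_exponent p m q :
  measurable_fun [set: R] (macdonald_exponent p m q).
Proof.
apply: measurable_funB; first apply: measurable_funB.
- exact: measurable_funM.
- by apply: measurable_funM => //; exact: measurable_expR.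
- apply: measurable_funM => //; apply: measurableT_comp => //.
Qed.

Lemma measurable_macdonald p m q :
  measurable_fun [set: R] (fun u => (expR (macdonald_exponent p m q u))%:E).
Proof.
apply/measurable_EFinP/measurableT_comp => //.
exact: measurable_macdonald_exponent.
Qed.

Lemma macdonald_ge0 p m q : (0 <= macdonald p m q)%E.
Proof. by apply: integral_ge0 => u _; rewrite lee_fin expR_ge0. Qed.

Lemma le_macdonald C p m q p' m' q' :
  (forall u, macdonald_exponent p m q u <= C + macdonald_exponent p' m' q' u) ->
  (macdonald p m q <= (expR C)%:E * macdonald p' m' q')%E.
Proof.
move=> h; rewrite /macdonald -ge0_integralZl_EFin ?expR_ge0//; last exact: measurable_macdonald.
apply: ge0_le_integral => //.
- exact: measurable_macdonald.
- by apply: measurable_funeM; exact: measurable_macdonald.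
- by move=> u _; rewrite -EFinM lee_fin -expRD ler_expR.
Qed.

Lemma macdonald_anti p m q m' q' : m' <= m -> q' <= q ->
  (macdonald p m q <= macdonald p m' q')%E.
Proof.
move=> mm qq; have := @le_macdonald 0 p m q p m' q'.
rewrite expR0 mul1e; apply => u; rewrite add0r.
have := ler_wpM2r (expR_ge0 u) mm; have := ler_wpM2r (expR_ge0 (- u)) qq.
by rewrite /macdonald_exponent; lra.
Qed.

(** A convex function lies above its tangent, here the one where the slopes
    agree. With a logarithm for [u] it says that exponentials beat powers. *)
Lemma ge_linear_expR m (k : R) : 0 < m -> 0 < k ->
  exists2 C : R, 0 <= C & forall u, k * u - m * expR u <= C.
Proof.
(* the maximum of [k u - m expR u], attained at [ln (k / m)] *)
move=> m0 k0; pose C := k * ln (k / m) - k.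
have km0 : 0 < k / m by rewrite divr_gt0.
have h u : k * u - m * expR u <= C.
  have := expR_ge1Dx (u - ln (k / m)).
  rewrite expRD expRN lnK ?posrE// => h.
  have -> : m * expR u = k * (expR u * (k / m)^-1).
    by field; rewrite !gt_eqF.
  rewrite /C; nra.
exists (Num.max 0 C); first by rewrite le_max lexx.
by move=> u; rewrite le_max h orbT.
Qed.

Lemma exponential_decay p m : 0 <= m -> 0 < m \/ p < 0 ->
  exists C c : R, [/\ 0 <= C, 0 < c & forall u, 0 <= u -> p * u - m * expR u <= C - c * u].
Proof.
move=> m0 h.
have [pn|p0] := ltP p 0.
  exists 0, (- p); split => //; first by rewrite oppr_gt0.
  by move=> u u0; have := mulr_ge0 m0 (expR_ge0 u); lra.
have {}m0 : 0 < m by case: h => //; lra.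
have [C C0 h1] := @ge_linear_expR m (p + 1) m0 ltac:(lra).
exists C, 1; split => // u u0; have := h1 u; lra.
Qed.

(** At each end of the line the integrand decays exponentially, thanks either
    to the double exponential there or to the sign of [p]. *)
Lemma macdonald_lty p m q : 0 <= m -> 0 <= q ->
  0 < m \/ p < 0 -> 0 < q \/ 0 < p -> (macdonald p m q < +oo)%E.
Proof.
move=> m0 q0 mp qp.
have [C1 [c1 [C10 c10 h1]]] := exponential_decay m0 mp.
have [|C2 [c2 [C20 c20 h2]]] := @exponential_decay (- p) q q0.
  by case: qp; [left|right; rewrite oppr_lt0].
have c0 : 0 < Num.min c1 c2 by rewrite lt_min c10.
apply: (@le_expRN_norm_integral_lty _ (expR (C1 + C2)) _ _ c0).
- apply: measurableT_comp => //; exact: measurable_macdonald_exponent.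
- by move=> u; exact: expR_ge0.
move=> u; rewrite -expRD ler_expR /macdonald_exponent.
have [u0|u0] := leP 0 u.
  rewrite ger0_norm//.
  have := h1 u u0; have := mulr_ge0 q0 (expR_ge0 (- u)).
  have : Num.min c1 c2 * u <= c1 * u by rewrite ler_wpM2r// ge_min lexx.
  lra.
rewrite ltr0_norm//.
have := h2 (- u) ltac:(lra); have := mulr_ge0 m0 (expR_ge0 u).
have : Num.min c1 c2 * (- u) <= c2 * (- u) by rewrite ler_wpM2r ?ge_min ?lexx ?orbT//; lra.
lra.
Qed.

Lemma macdonald_shift p m q a :
  macdonald p m q =
  ((expR (p * a))%:E * macdonald p (m * expR a) (q * expR (- a)))%E.
Proof.
rewrite /macdonald -(ge0_integral_shift a).
- rewrite -ge0_integralZl_EFin ?expR_ge0//; last exact: measurable_macdonald.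
  apply: eq_integral => u _; rewrite -EFinM -expRD; congr (expR _)%:E.
  by rewrite /macdonald_exponent opprD !expRD; ring.
- exact: measurable_macdonald.
- by move=> u; rewrite lee_fin expR_ge0.
Qed.

End macdonald.

Section macdonald_bounds.
Context {R : realType}.
Local Notation leb := (@lebesgue_measure R).
Implicit Types p m q u v : R.

(** Half of [k^2 t + rho^2/(4t)] is at least [k rho / 2] by the inequality of
    arithmetic and geometric means; the other half is kept to make the integral
    converge. *)
Lemma macdonald_decay p (k rho : R) :
  (macdonald p (k ^+ 2) (rho ^+ 2 / 4) <=
   (expR (- (k * rho / 2)))%:E * macdonald p (k ^+ 2 / 2) (rho ^+ 2 / 8))%E.
Proof.
apply: le_macdonald => u; rewrite /macdonald_exponent.
have e1 : expR u = expR (u / 2) ^+ 2 by rewrite -expRM_natr; congr expR; field.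
have e2 : expR (- u) = expR (- u / 2) ^+ 2 by rewrite -expRM_natr; congr expR; field.
have e3 : expR (u / 2) * expR (- u / 2) = 1.
  by rewrite -expRD -[RHS]expR0; congr expR; ring.
have := sqr_ge0 (k * expR (u / 2) - rho / 2 * expR (- u / 2)).
have -> : (k * expR (u / 2) - rho / 2 * expR (- u / 2)) ^+ 2 =
  k ^+ 2 * expR u + rho ^+ 2 / 4 * expR (- u) - k * rho.
  rewrite e1 e2; move: (expR (u / 2)) (expR (- u / 2)) e3 => A B e3.
  transitivity (k ^+ 2 * A ^+ 2 + rho ^+ 2 / 4 * B ^+ 2 - k * rho * (A * B)).
    by field.
  by rewrite e3 mulr1.
lra.
Qed.

Lemma sqr_expR_ln (rho : R) : 0 < rho -> expR (2 * ln rho) = rho ^+ 2.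
Proof.
by move=> r0; rewrite mulrC expRM_natr lnK// posrE.
Qed.

(** The scaling [t = rho^2 t'], which brings out the power [rho^(2p)]. *)
Lemma macdonald_shift_sqr p m c (rho : R) : 0 < rho ->
  macdonald p m (c * rho ^+ 2) =
  ((expR (2 * p * ln rho))%:E * macdonald p (m * rho ^+ 2) c)%E.
Proof.
move=> r0; rewrite (macdonald_shift _ _ _ (2 * ln rho)).
rewrite expRN sqr_expR_ln// mulfK ?expf_neq0 ?gt_eqF//.
by congr ((expR _)%:E * _)%E; ring.
Qed.

Lemma macdonald_neg_le p (k rho : R) : 0 < rho ->
  (macdonald p (k ^+ 2) (rho ^+ 2 / 4) <=
   (expR (2 * p * ln rho - k * rho / 2))%:E * macdonald p 0 8^-1)%E.
Proof.
move=> r0; apply: (le_trans (macdonald_decay _ _ _)).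
rewrite addrC expRD EFinM -muleA lee_pmul2l ?fin_num_fun//; last first.
  by rewrite lte_fin expR_gt0.
rewrite -[X in (_ <= _ * macdonald _ X _)%E](mul0r (rho ^+ 2)).
rewrite -macdonald_shift_sqr// [X in (_ <= macdonald _ _ X)%E]mulrC.
by apply: macdonald_anti => //; rewrite divr_ge0 ?sqr_ge0.
Qed.

(** The integrand is bounded below on one interval of length [1] placed where
    it is close to its maximum: [t] of order [rho^2] for small [rho] and of
    order [rho] for large [rho]. *)
Lemma macdonald_neg_ge p m (rho : R) : p <= 0 -> 0 <= m -> 0 < rho ->
  ((expR (p + 2 * p * ln rho - m * expR 1 * rho - (1 + rho) / 4))%:E <=
   macdonald p m (rho ^+ 2 / 4))%E.
Proof.
move=> p0 m0 r0.
have r10 : 0 < 1 + rho by lra.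
(* [tau] interpolates between [rho^2] and [rho]; then [m tau] and
   [rho^2 / (4 tau)] grow at most linearly in [rho] *)
pose tau : R := rho ^+ 2 / (1 + rho).
have r20 : 0 < rho ^+ 2 by rewrite exprn_gt0.
have tau0 : 0 < tau by rewrite divr_gt0.
set E := (E in expR E).
have := @ge_integral_itv R (ln tau) (ln tau + 1) (expR E)
  (fun u => expR (macdonald_exponent p m (rho ^+ 2 / 4) u)).
rewrite addrAC subrr add0r mulr1; apply.
- by rewrite lerDl.
- exact: expR_ge0.
- by apply: measurableT_comp => //; exact: measurable_macdonald_exponent.
- by move=> u; exact: expR_ge0.
move=> u /andP[u1 u2]; rewrite ler_expR /E /macdonald_exponent.
have lnle : ln tau <= 2 * ln rho.
  rewrite mulr_natl -lnXn// ler_ln ?posrE//.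
  by rewrite ler_pdivrMr// ler_peMr ?(ltW r20)//; lra.
have pu : p + 2 * p * ln rho <= p * u.
  apply: (@le_trans _ _ (p * (ln tau + 1))); last by rewrite ler_wnM2l.
  rewrite [_ + _](_ : _ = p * (2 * ln rho + 1)); last by ring.
  by rewrite ler_wnM2l// lerD2r.
have mu : m * expR u <= m * expR 1 * rho.
  rewrite -mulrA ler_wpM2l//.
  apply: (@le_trans _ _ (expR (1 + ln tau))); first by rewrite ler_expR addrC.
  rewrite expRD lnK ?posrE// ler_wpM2l ?expR_ge0// /tau ler_pdivrMr//.
  by rewrite expr2 ler_pM2l//; lra.
have qu : rho ^+ 2 / 4 * expR (- u) <= (1 + rho) / 4.
  apply: (@le_trans _ _ (rho ^+ 2 / 4 * expR (- ln tau))).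
    by rewrite ler_wpM2l ?divr_ge0 ?sqr_ge0// ler_expR; lra.
  rewrite expRN lnK ?posrE// /tau le_eqVlt; apply/orP; left; apply/eqP.
  by field; rewrite !gt_eqF.
lra.
Qed.

(** For [rho^2 <= t <= 1] the exponential factors are bounded below, and that
    interval has length [2 log(1/rho)] for [dt/t]. *)
Lemma macdonald0_ge m (rho : R) : 0 <= m -> 0 < rho <= 1 ->
  ((expR (- m - 4^-1) * (2 * - ln rho))%:E <= macdonald 0 m (rho ^+ 2 / 4))%E.
Proof.
move=> m0 /andP[r0 r1].
have l0 : ln rho <= 0 by exact: ln_le0.
have := @ge_integral_itv R (2 * ln rho) 0 (expR (- m - 4^-1))
  (fun u => expR (macdonald_exponent 0 m (rho ^+ 2 / 4) u)).
rewrite sub0r -mulrN; apply.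
- lra.
- exact: expR_ge0.
- by apply: measurableT_comp => //; exact: measurable_macdonald_exponent.
- by move=> u; exact: expR_ge0.
move=> u /andP[u1 u2]; rewrite ler_expR /macdonald_exponent mul0r sub0r lerB//.
  by rewrite lerN2 ler_piMr// -expR0 ler_expR.
apply: (@le_trans _ _ (rho ^+ 2 / 4 * expR (- (2 * ln rho)))).
  by rewrite ler_wpM2l ?divr_ge0 ?sqr_ge0// ler_expR lerN2.
rewrite expRN sqr_expR_ln// mulrAC mulfV ?mul1r// expf_neq0// gt_eqF//.
Qed.

(** The integrand is at most [1] on [rho^2 <= t <= 1]; on the two remaining
    half-lines it is at most that of a convergent integral, with the exponent
    [1] on the right and, after the scaling by [rho^2], [-1] on the left. *)
Lemma macdonald0_le m (rho : R) : 0 <= m -> 0 < rho <= 1 ->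
  (macdonald 0 m (rho ^+ 2 / 4) <=
   (2 * - ln rho)%:E + (macdonald 1 m 0 + macdonald (-1) 0 4^-1))%E.
Proof.
move=> m0 /andP[r0 r1].
have l0 : ln rho <= 0 by exact: ln_le0.
have -> : macdonald (-1) 0 4^-1 =
    ((expR (2 * ln rho))%:E * macdonald (-1) 0 (rho ^+ 2 / 4))%E.
  rewrite [(rho ^+ 2 / 4)]mulrC macdonald_shift_sqr// mul0r muleA -EFinM -expRD.
  by rewrite [X in expR X](_ : _ = 0) ?expR0 ?mul1e//; ring.
have -> : ((2 * - ln rho)%:E = \int[leb]_u (\1_(`[2 * ln rho, 0]%classic) u)%:E)%E.
  rewrite integral_indic//= setIT lebesgue_measure_itv/= lte_fin.
  case: ltP => l1; first by rewrite -EFinD sub0r mulrN.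
  by congr EFin; lra.
rewrite /macdonald -ge0_integralZl_EFin ?expR_ge0//; last exact: measurable_macdonald.
rewrite -ge0_integralD//; [|exact: measurable_macdonald| ]; last first.
  by apply: measurable_funeM; exact: measurable_macdonald.
rewrite -ge0_integralD//; last 3 first.
- exact: measurableT_comp.
- by move=> u _; rewrite adde_ge0// mule_ge0// lee_fin expR_ge0.
- apply: emeasurable_funD; first exact: measurable_macdonald.
  by apply: measurable_funeM; exact: measurable_macdonald.
  apply: ge0_le_integral => //.
  - exact: measurable_macdonald.
  - apply: emeasurable_funD; first exact: measurableT_comp.
    apply: emeasurable_funD; first exact: measurable_macdonald.
    by apply: measurable_funeM; exact: measurable_macdonald.
  move=> u _; rewrite -EFinM -!EFinD lee_fin -expRD /macdonald_exponent.
  have qe : 0 <= rho ^+ 2 / 4 * expR (- u).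
    by rewrite mulr_ge0 ?expR_ge0 ?divr_ge0 ?sqr_ge0.
  have me : 0 <= m * expR u by rewrite mulr_ge0 ?expR_ge0.
  have [u0|u0] := leP 0 u.
    apply: ler_wpDl => //; apply: ler_wpDr; first exact: expR_ge0.
    by rewrite ler_expR; lra.
  have [u1|u1] := leP u (2 * ln rho).
    apply: ler_wpDl => //; apply: ler_wpDl; first exact: expR_ge0.
    by rewrite ler_expR; lra.
  rewrite indicE mem_set/=; last by rewrite in_itv/= !ltW.
  apply: ler_wpDr; first by rewrite addr_ge0 ?expR_ge0.
  by rewrite -[leRHS]expR0 ler_expR; lra.
Qed.

Lemma macdonald_fin_num (p m q : R) : 0 <= m -> 0 <= q ->
  0 < m \/ p < 0 -> 0 < q \/ 0 < p -> macdonald p m q \is a fin_num.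
Proof. by move=> *; rewrite ge0_fin_numE ?macdonald_ge0// macdonald_lty. Qed.

Lemma macdonald_gt0 (p m q : R) : 0 <= m -> 0 <= q -> (0 < macdonald p m q)%E.
Proof.
move=> m0 q0; pose c := expR (- `|p| - m * expR 1 - q).
have := @ge_integral_itv R 0 1 c (fun u => expR (macdonald_exponent p m q u)).
move=> h; apply: lt_le_trans (h _ _ _ _ _) => //.
- by rewrite subr0 mulr1 lte_fin expR_gt0.
- exact: expR_ge0.
- by apply: measurableT_comp => //; exact: measurable_macdonald_exponent.
move=> u /andP[u0 u1]; rewrite ler_expR /macdonald_exponent.
have h1 : m * expR u <= m * expR 1 by rewrite ler_wpM2l// ler_expR.
have h2 : q * expR (- u) <= q by rewrite ler_piMr// -expR0 ler_expR oppr_le0.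
have h3 : - `|p| <= p * u.
  have : `|p * u| <= `|p| by rewrite normrM ler_piMr// ger0_norm.
  by rewrite ler_norml => /andP[].
lra.
Qed.

(** With [q = 0] and [p <= 0] the integrand is bounded below on the whole
    negative half-line. *)
Lemma macdonald_pinfty (p m : R) : p <= 0 -> 0 <= m -> macdonald p m 0 = +oo%E.
Proof.
move=> p0 m0; apply/eqyP => A A0.
have := @ge_integral_itv R (- (A * expR m)) 0 (expR (- m))
  (fun u => expR (macdonald_exponent p m 0 u)).
rewrite sub0r opprK mulrCA -expRD addNr expR0 mulr1; apply.
- by rewrite oppr_le0 mulr_ge0 ?expR_ge0// ltW.
- exact: expR_ge0.
- by apply: measurableT_comp => //; exact: measurable_macdonald_exponent.
- by move=> u; exact: expR_ge0.
move=> u /andP[u1 u2]; rewrite ler_expR /macdonald_exponent mul0r subr0.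
have : 0 <= p * u by rewrite mulr_le0.
have : m * expR u <= m by rewrite ler_piMr// -expR0 ler_expR.
lra.
Qed.

End macdonald_bounds.

(** * The additive convolution of Gamma densities *)

Section beta.
Context {R : realType}.
Local Notation leb := (@lebesgue_measure R).

Definition beta_exponent (a v : R) : R := a * v - 2 * a * ln (1 + expR v).

(** The Euler integral [B(a, a)], written in the variable [v] for which
    [expR v] is the ratio of the two variables of the beta density. *)
Definition beta_integral (a : R) : \bar R :=
  (\int[leb]_v (expR (beta_exponent a v))%:E)%E.

Lemma measurable_beta_exponent a : measurable_fun [set: R] (beta_exponent a).
Proof.
apply: measurable_funB; first exact: measurable_funM.
apply: measurable_funM => //; apply: measurableT_comp => //.
exact: measurable_funD.
Qed.

Lemma beta_integral_gt0 a : 0 < a -> (0 < beta_integral a)%E.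
Proof.
move=> a0.
apply: (@lt_le_trans _ _ (expR (- (2 * a * ln (1 + expR 1))) * (1 - 0))%:E).
  by rewrite lte_fin subr0 mulr1 expR_gt0.
apply: ge_integral_itv => //.
- by apply: measurableT_comp => //; exact: measurable_beta_exponent.
move=> u /andP[u0 u1]; rewrite ler_expR /beta_exponent.
have := mulr_ge0 (ltW a0) u0.
have : 2 * a * ln (1 + expR u) <= 2 * a * ln (1 + expR 1).
  apply: ler_wpM2l; first lra.
  rewrite ler_ln ?posrE ?addr_gt0 ?expR_gt0//.
  by rewrite lerD2l ler_expR.
lra.
Qed.

Lemma beta_integral_lty a : 0 < a -> (beta_integral a < +oo)%E.
Proof.
move=> a0.
apply: (@le_expRN_norm_integral_lty _ 1 _ _ a0).
- by apply: measurableT_comp => //; exact: measurable_beta_exponent.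
- by move=> u; exact: expR_ge0.
move=> u; rewrite mul1r ler_expR /beta_exponent.
have e1 : 0 < 1 + expR u by rewrite addr_gt0 ?expR_gt0.
have l1 : 0 <= ln (1 + expR u) by rewrite ln_ge0// lerDl expR_ge0.
have l2 : u <= ln (1 + expR u).
  by rewrite -{1}(expRK u) ler_ln ?posrE ?expR_gt0// lerDr.
have := mulr_ge0 (ltW a0) l1.
have := ler_wpM2l (ltW a0) l2.
have [u0|u0] := leP 0 u; [rewrite ger0_norm//|rewrite ltr0_norm//]; lra.
Qed.

(** The measure [sigma^a tau^a] on pairs, for [d sigma / sigma] and
    [d tau / tau], is pushed by addition to [B(a, a)] times the measure with
    density [u^(2a)] for [du/u]. In logarithmic variables the ratio
    [tau / sigma] is a translation, and once it is frozen [sigma + tau] is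
    another translation of [sigma]. *)
Lemma beta_mixture (a : R) (Phi : R -> \bar R) :
  measurable_fun [set: R] Phi -> (forall u, 0 <= Phi u)%E ->
  (\int[leb]_s \int[leb]_t ((expR (a * s + a * t))%:E *
      Phi (ln (expR s + expR t))))%E =
  (beta_integral a * \int[leb]_u ((expR (2 * a * u))%:E * Phi u))%E.
Proof.
move=> mPhi Phi0.
have lnE (s t : R) : ln (expR s + expR (t + s)) = s + ln (1 + expR t).
  have -> : expR s + expR (t + s) = expR s * (1 + expR t).
    by rewrite expRD; ring.
  by rewrite lnM ?posrE ?expR_gt0 ?addr_gt0 ?expR_gt0// expRK.
have mln : measurable_fun [set: R] (fun t : R => ln (1 + expR t)).
  by apply: measurableT_comp => //; exact: measurable_funD.
under eq_integral => s _.
  rewrite -(ge0_integral_shift s); last 2 first.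
  - apply: emeasurable_funM.
      apply: measurableT_comp => //; apply: measurableT_comp => //.
      by apply: measurable_funD => //; exact: measurable_funM.
    apply: measurableT_comp => //; apply: measurableT_comp => //.
    exact: measurable_funD.
  - by move=> x; rewrite mule_ge0// lee_fin expR_ge0.
  under eq_integral do rewrite lnE.
  over.
transitivity (\int[leb]_t \int[leb]_s ((expR (a * s + a * (t + s)))%:E *
    Phi (s + ln (1 + expR t))%R))%E.
  apply: (lebesgue_tonelli_plane (f := fun st : R * R =>
    ((expR (a * st.1 + a * (st.2 + st.1)))%:E *
      Phi (st.1 + ln (1 + expR st.2))%R)%E)).
    apply: emeasurable_funM.
      apply: measurableT_comp => //; apply: measurableT_comp => //.
      apply: measurable_funD; apply: measurable_funM => //.
      exact: measurable_funD.
    apply: measurableT_comp => //; apply: measurable_funD => //.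
    by apply: (measurableT_comp mln).
  by move=> x; rewrite mule_ge0// lee_fin expR_ge0.
rewrite /beta_integral -ge0_integralZr//; last 2 first.
- by apply: measurableT_comp => //; apply: measurableT_comp => //; exact: measurable_beta_exponent.
- by apply: integral_ge0 => u _; rewrite mule_ge0// lee_fin expR_ge0.
apply: eq_integral => t _.
set L := ln (1 + expR t).
rewrite -[in RHS](ge0_integral_shift L); last 2 first.
- apply: emeasurable_funM => //.
  by apply: measurableT_comp => //; apply: measurableT_comp => //; exact: measurable_funM.
- by move=> x; rewrite mule_ge0// lee_fin expR_ge0.
rewrite -ge0_integralZl//.
- apply: eq_integral => s _; rewrite muleA -EFinM -expRD.
  by congr ((expR _)%:E * _)%E; rewrite /beta_exponent -/L; ring.
- apply: emeasurable_funM.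
    apply: measurableT_comp => //; apply: measurableT_comp => //.
    by apply: measurable_funM => //; exact: measurable_funD.
  by apply: measurableT_comp => //; exact: measurable_funD.
- by move=> x _; rewrite mule_ge0// lee_fin expR_ge0.
Qed.

End beta.

(** * Fourier transform of Gaussians on the line *)

Section gauss1.
Context {R : realType}.
Local Notation leb := (@lebesgue_measure R).

(** Integration by parts without boundary term: the fundamental theorem on
    [[-n, n]] and dominated convergence. *)
Lemma Rintegral_derive_eq0 (F f : R -> R) :
  (forall x : R, is_derive x 1 F (f x)) -> continuous f ->
  leb.-integrable [set: R] (EFin \o f) ->
  F n%:R @[n --> \oo] --> 0 -> F (- n%:R) @[n --> \oo] --> 0 ->
  Rintegral leb setT f = 0.
Proof.
move=> dF cf If Fy FNy.
pose g n : R -> \bar R := (EFin \o f) \_ `[- n.+1%:R, n.+1%:R]%classic.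
have mf : measurable_fun [set: R] (EFin \o f) by exact: (measurable_int leb).
have mg n : measurable_fun [set: R] (g n).
  apply/(measurable_restrictT _ _).1 => //.
  exact: measurable_funTS.
have gf x : g n x @[n --> \oo] --> (f x)%:E.
  apply: cvg_near_cst.
  near=> n; rewrite /g patchE mem_set//= in_itv/= -ler_norml.
  apply: ltW; near: n.
  exists (Num.truncn `|x|) => // n /= h.
  apply: (lt_le_trans (truncnS_gt _)).
  by rewrite ler_nat.
have gle n x : (`|g n x| <= `|(f x)%:E|)%E.
  by rewrite /g patchE; case: ifP => // _; rewrite abse0.
have If' : leb.-integrable [set: R] (abse \o (EFin \o f)) by exact: integrable_abse.
have [||_ _ h] := @dominated_convergence _ _ _ leb setT measurableT
  g (EFin \o f) _ mg mf _ If' _.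
- by apply: aeW => x _; exact: gf.
- by apply: aeW => x n _; exact: gle.
have cF x : {for x, continuous F}.
  by apply: differentiable_continuous; apply/derivable1_diffP; apply: ex_derive.
have gE n : (\int[leb]_x g n x = (F n.+1%:R - F (- n.+1%:R))%:E)%E.
  rewrite /g -integral_mkcond EFinB.
  apply: continuous_FTC2.
  - by rewrite (@lt_trans _ _ 0)// oppr_lt0.
  - exact: continuous_subspaceT.
  - split.
    + by move=> x _; exact: ex_derive.
    + exact/cvg_at_right_filter/cF.
    + exact/cvg_at_left_filter/cF.
  - by move=> x _; rewrite derive1E; apply: derive_val.
have h0 : (F n.+1%:R - F (- n.+1%:R))%:E @[n --> \oo] --> 0%E.
  apply: cvg_EFin; first by near=> n.
  rewrite -[X in _ --> X](subr0 0).
  by apply: cvgB; [rewrite (cvg_shiftS (fun n => F n%:R))|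
    rewrite (cvg_shiftS (fun n => F (- n%:R)))].
rewrite /Rintegral.
suff -> : (\int[leb]_x (f x)%:E = 0)%E by [].
apply: (cvg_unique _ _ h0) => //.
by move: h; under eq_fun do rewrite gE.
Unshelve. all: by end_near. Qed.

Definition gauss_weight (c y x : R) : R := expR (- c * (x - y) ^+ 2).

Lemma continuous_gauss_weight c y : continuous (gauss_weight c y).
Proof.
move=> x; apply: differentiable_continuous; apply/derivable1_diffP.
exact: ex_derive.
Qed.

Lemma measurable_gauss_weight c y : measurable_fun [set: R] (gauss_weight c y).
Proof. exact: continuous_measurable_fun (@continuous_gauss_weight c y). Qed.

Lemma integral_gauss_weight c y : 0 < c ->
  (\int[leb]_x (gauss_weight c y x)%:E = (Num.sqrt (pi / c))%:E)%E.
Proof.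
move=> c0; pose s := Num.sqrt (2 * c)^-1.
have s0 : s != 0 by rewrite gt_eqF// sqrtr_gt0 invr_gt0 mulr_gt0.
have s2 : s ^+ 2 = (2 * c)^-1 by rewrite sqr_sqrtr// invr_ge0 mulr_ge0// ltW.
have pE : (normal_peak s)^-1 = Num.sqrt (pi / c).
  by rewrite /normal_peak invrK s2; congr Num.sqrt; field; rewrite gt_eqF.
have := @integral_normal_pdf R y s.
under eq_integral => x _.
  rewrite normal_pdfE// /normal_fun s2.
  have -> : - (x - y) ^+ 2 / ((2 * c)^-1 *+ 2) = - c * (x - y) ^+ 2.
    by field; rewrite gt_eqF.
  rewrite EFinM; over.
rewrite ge0_integralZl_EFin//; last 2 first.
- by apply: measurableT_comp => //; exact: measurable_gauss_weight.
- exact: normal_peak_ge0.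
rewrite -/(gauss_weight c y) => h.
have p0 := normal_peak_gt0 s0.
rewrite -pE -[LHS]mul1e -(@mulVf _ (normal_peak s)) ?gt_eqF// EFinM -muleA.
by rewrite h mule1.
Qed.

Lemma integrable_gauss_weight c y : 0 < c ->
  leb.-integrable [set: R] (EFin \o gauss_weight c y).
Proof.
move=> c0; apply/integrableP; split.
  by apply: measurableT_comp => //; exact: measurable_gauss_weight.
under eq_integral do rewrite /= ger0_norm ?expR_ge0//.
by rewrite integral_gauss_weight// ltry.
Qed.

(** A first moment is absorbed by halving the rate of the Gaussian; this bound
    dominates the derivative of the Fourier integrals. *)
Lemma norm_gauss_weight_le (c y x : R) : 0 < c ->
  `|x| * gauss_weight c y x <= (`|y| + 1 + 2 / c) * gauss_weight (c / 2) y x.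
Proof.
move=> c0; rewrite /gauss_weight.
have -> : - c * (x - y) ^+ 2 = - (c / 2) * (x - y) ^+ 2 - c / 2 * (x - y) ^+ 2 by field.
rewrite expRD mulrCA mulrC ler_wpM2r ?expR_ge0// expRN ler_pdivrMr ?expR_gt0//.
set z := x - y.
have xE : `|x| <= `|y| + `|z| by rewrite -[x in `|x|](subrK y) addrC ler_normD.
have z2 : `|z| <= 1 + z ^+ 2.
  have := sqr_ge0 (`|z| - 1); rewrite sqrrB1 real_normK ?num_real//.
  have := sqr_ge0 z; lra.
have e1 : 1 + c / 2 * z ^+ 2 <= expR (c / 2 * z ^+ 2) by exact: expR_ge1Dx.
have K0 : 0 <= `|y| + 1 + 2 / c by rewrite !addr_ge0// divr_ge0// ltW.
apply: le_trans (ler_wpM2l K0 e1).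
apply: (le_trans xE).
have -> : (`|y| + 1 + 2 / c) * (1 + c / 2 * z ^+ 2) =
  (`|y| + 1 + z ^+ 2) + (2 / c + (`|y| + 1) * (c / 2 * z ^+ 2)).
  by field; rewrite gt_eqF.
have : 0 <= 2 / c + (`|y| + 1) * (c / 2 * z ^+ 2).
  have cz : 0 <= c / 2 * z ^+ 2 by rewrite mulr_ge0 ?sqr_ge0// divr_ge0// ltW.
  apply: addr_ge0; first by rewrite divr_ge0// ltW.
  by apply: mulr_ge0 => //; rewrite addr_ge0.
lra.
Qed.

Lemma integrable_bounded_gauss (h : R -> R) (c y : R) : 0 < c ->
  measurable_fun [set: R] h -> (forall x, `|h x| <= 1) ->
  leb.-integrable [set: R] (fun x => (h x * gauss_weight c y x)%:E).
Proof.
move=> c0 mh h1; apply: (le_integrable measurableT _ _ (integrable_gauss_weight y c0)).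
  apply: measurableT_comp => //; apply: measurable_funM => //.
  exact: measurable_gauss_weight.
by move=> x _; rewrite !abse_EFin lee_fin normrM ler_piMl.
Qed.

Lemma integrable_moment_gauss (h : R -> R) (c y : R) : 0 < c ->
  measurable_fun [set: R] h -> (forall x, `|h x| <= 1) ->
  leb.-integrable [set: R] (fun x => (x * h x * gauss_weight c y x)%:E).
Proof.
move=> c0 mh h1.
have c20 : 0 < c / 2 by rewrite divr_gt0.
apply: (le_integrable measurableT _ _
  (@integrableZl _ _ _ _ _ measurableT (`|y| + 1 + 2 / c) _ (integrable_gauss_weight y c20))).
  apply: measurableT_comp => //; apply: measurable_funM => //.
    exact: measurable_funM.
  exact: measurable_gauss_weight.
move=> x _; rewrite /= lee_fin.
apply: (le_trans _ (ler_norm _)).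
apply: (le_trans _ (norm_gauss_weight_le y x c0)).
rewrite !normrM (@ger0_norm _ (gauss_weight _ _ _)) ?expR_ge0//.
by rewrite ler_wpM2r ?expR_ge0// ler_piMr.
Qed.

Definition gauss_cos (c y xi : R) : R := Rintegral leb setT (fun x => cos (x * xi) * gauss_weight c y x).
Definition gauss_sin (c y xi : R) : R := Rintegral leb setT (fun x => sin (x * xi) * gauss_weight c y x).

Lemma is_derive_gauss_weight (c y x : R) :
  is_derive x 1 (gauss_weight c y) (- 2 * c * (x - y) * gauss_weight c y x).
Proof.
rewrite /gauss_weight; apply: trigger_derive; rewrite /GRing.scale /=.
ring.
Qed.

Lemma is_derive_cos_lin (xi x : R) : is_derive x 1 (fun x => cos (x * xi)) (- xi * sin (x * xi)).
Proof.
apply: trigger_derive; rewrite /GRing.scale /=; ring.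
Qed.

Lemma is_derive_sin_lin (xi x : R) : is_derive x 1 (fun x => sin (x * xi)) (xi * cos (x * xi)).
Proof.
apply: trigger_derive; rewrite /GRing.scale /=; ring.
Qed.

Lemma measurable_cos_lin (xi : R) : measurable_fun [set: R] (fun x => cos (x * xi)).
Proof.
apply: continuous_measurable_fun => x.
by apply: differentiable_continuous; apply/derivable1_diffP; apply: ex_derive.
Qed.

Lemma measurable_sin_lin (xi : R) : measurable_fun [set: R] (fun x => sin (x * xi)).
Proof.
apply: continuous_measurable_fun => x.
by apply: differentiable_continuous; apply/derivable1_diffP; apply: ex_derive.
Qed.

Lemma is_derive_gauss_under (t t' : R -> R) (c y xi : R) : 0 < c ->
  (forall x : R, is_derive x 1 t (t' x)) ->
  (forall x, `|t x| <= 1) -> (forall x, `|t' x| <= 1) ->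
  is_derive xi 1 (fun xi => Rintegral leb setT (fun x => t (x * xi) * gauss_weight c y x))
    (Rintegral leb setT (fun x => x * t' (x * xi) * gauss_weight c y x)).
Proof.
move=> c0 dt t1 t'1.
pose f (xi x : R) := t (x * xi) * gauss_weight c y x.
have cc (u : R -> R) (u' : R -> R) : (forall x : R, is_derive x 1 u (u' x)) -> continuous u.
  move=> du x.
  by apply: differentiable_continuous; apply/derivable1_diffP; apply: ex_derive.
have mt z : measurable_fun [set: R] (fun x => t (x * z)).
  apply: (measurableT_comp (continuous_measurable_fun (cc _ _ dt))) => //.
  exact: measurable_funM.
have df (z x : R) : is_derive z 1 (f ^~ x) (x * t' (x * z) * gauss_weight c y x).
  rewrite /f; apply: trigger_derive; rewrite /GRing.scale /=; ring.
have intf z : `]xi - 1, xi + 1[%classic z -> leb.-integrable setT (EFin \o f z).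
  by move=> _; apply: integrable_bounded_gauss.
have derf z x : `]xi - 1, xi + 1[%classic z -> setT x -> derivable (f^~ x) z 1.
  by move=> _ _; exact: ex_derive.
have c20 : 0 < c / 2 by rewrite divr_gt0.
pose G x := (`|y| + 1 + 2 / c) * gauss_weight (c / 2) y x.
have G0 x : 0 <= G x.
  by rewrite mulr_ge0 ?expR_ge0// !addr_ge0// divr_ge0// ltW.
have IG : leb.-integrable setT (EFin \o G).
  exact: (@integrableZl _ _ _ _ _ measurableT (`|y| + 1 + 2 / c) _ (integrable_gauss_weight y c20)).
have d1E z x : partial1of2 f z x = x * t' (x * z) * gauss_weight c y x.
  by rewrite /partial1of2 derive1E; apply: derive_val.
have Gub z x : `]xi - 1, xi + 1[%classic z -> setT x -> `|partial1of2 f z x| <= G x.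
  move=> _ _; rewrite d1E; apply: (le_trans _ (norm_gauss_weight_le y x c0)).
  rewrite !normrM (@ger0_norm _ (gauss_weight _ _ _)) ?expR_ge0//.
  by rewrite ler_wpM2r ?expR_ge0// ler_piMr.
have xiI : `]xi - 1, xi + 1[%classic xi by rewrite /= in_itv/=; lra.
apply: DeriveDef.
  exact: (derivable_under_integral measurableT xiI intf derf G0 IG Gub).
rewrite -derive1E (differentiation_under_integral measurableT xiI intf derf G0 IG Gub).
by apply: eq_Rintegral => x _; rewrite /= d1E.
Qed.

Lemma gauss_weight_cvg0 (h : R -> R) (c y : R) (x_ : nat -> R) : 0 < c ->
  (forall x, `|h x| <= 1) -> (forall n, `|x_ n| = n%:R) ->
  h (x_ n) * gauss_weight c y (x_ n) @[n --> \oo] --> 0.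
Proof.
move=> c0 h1 xn; apply/cvgr0Pnorm_lt => eps eps0.
set K := `|y| + 1 + 2 / c.
have K0 : 0 <= K by rewrite !addr_ge0// divr_ge0// ltW.
near=> n.
have n0 : K / eps < n%:R by near: n; exact: nbhs_infty_gtr.
have n1 : 0 < n%:R :> R by apply: le_lt_trans n0; rewrite divr_ge0// ltW.
rewrite normrM (@ger0_norm _ (gauss_weight _ _ _)) ?expR_ge0//.
apply: (@le_lt_trans _ _ (gauss_weight c y (x_ n))); first by rewrite ler_piMl ?expR_ge0.
have := norm_gauss_weight_le y (x_ n) c0; rewrite xn -/K => h2.
have h3 : gauss_weight (c / 2) y (x_ n) <= 1.
  rewrite -[leRHS]expR0 ler_expR mulNr oppr_le0 mulr_ge0 ?sqr_ge0//.
  by rewrite divr_ge0// ltW.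
rewrite -(ltr_pM2l n1); apply: (le_lt_trans h2).
apply: (@le_lt_trans _ _ K); first by rewrite ler_piMr.
by rewrite mulrC -ltr_pdivrMl// mulrC.
Unshelve. all: by end_near. Qed.

(** The factor [x] is traded for a derivative: [2 c (x - y)] times the Gaussian
    is minus its derivative, and the integral of the derivative of
    [sin(x xi)] or [cos(x xi)] times the Gaussian vanishes. *)
Lemma gauss_cos_sin_by_parts (c y xi : R) : 0 < c ->
  Rintegral leb setT (fun x => x * - sin (x * xi) * gauss_weight c y x) =
    - (y * gauss_sin c y xi + xi / (2 * c) * gauss_cos c y xi) /\
  Rintegral leb setT (fun x => x * cos (x * xi) * gauss_weight c y x) =
    y * gauss_cos c y xi - xi / (2 * c) * gauss_sin c y xi.
Proof.
move=> c0.
have mc := measurable_cos_lin xi; have ms := measurable_sin_lin xi.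
have Ic := @integrable_bounded_gauss _ c y c0 mc (fun x => cos_max _).
have Is := @integrable_bounded_gauss _ c y c0 ms (fun x => sin_max _).
have Mc := @integrable_moment_gauss _ c y c0 mc (fun x => cos_max _).
have Ms := @integrable_moment_gauss _ c y c0 ms (fun x => sin_max _).
have int_comb (k1 k2 k3 : R) (f1 f2 f3 : R -> R) :
  leb.-integrable setT (EFin \o f1) -> leb.-integrable setT (EFin \o f2) ->
  leb.-integrable setT (EFin \o f3) ->
  leb.-integrable setT (EFin \o (fun x => k1 * f1 x + k2 * f2 x + k3 * f3 x)) /\
  Rintegral leb setT (fun x => k1 * f1 x + k2 * f2 x + k3 * f3 x) =
  k1 * Rintegral leb setT f1 + k2 * Rintegral leb setT f2 + k3 * Rintegral leb setT f3.
  move=> i1 i2 i3.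
  have j1 : leb.-integrable setT (EFin \o (fun x => k1 * f1 x)) by exact: (integrableZl measurableT k1 i1).
  have j2 : leb.-integrable setT (EFin \o (fun x => k2 * f2 x)) by exact: (integrableZl measurableT k2 i2).
  have j3 : leb.-integrable setT (EFin \o (fun x => k3 * f3 x)) by exact: (integrableZl measurableT k3 i3).
  have j12 : leb.-integrable setT (EFin \o (fun x => k1 * f1 x + k2 * f2 x)).
    exact: (integrableD measurableT j1 j2).
  split; first exact: (integrableD measurableT j12 j3).
  by rewrite RintegralD// RintegralD// !RintegralZl.
pose w := gauss_weight c y.
have dw x := is_derive_gauss_weight c y x.
have dsin x := is_derive_sin_lin xi x.
have dcos x := is_derive_cos_lin xi x.
have [n1 n2] : (forall n : nat, `|n%:R : R| = n%:R) /\ (forall n : nat, `|- n%:R : R| = n%:R).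
  by split=> n; rewrite ?normrN normr_nat.
have contw (f : R -> R) : continuous f -> continuous (fun x => f x * w x).
  by move=> cf x; apply: cvgM; [exact: cf|exact: continuous_gauss_weight].
have contc : continuous (fun x : R => cos (x * xi)).
  by move=> x; apply: differentiable_continuous; apply/derivable1_diffP; apply: ex_derive.
have conts : continuous (fun x : R => sin (x * xi)).
  by move=> x; apply: differentiable_continuous; apply/derivable1_diffP; apply: ex_derive.
have contx (f : R -> R) : continuous f -> continuous (fun x : R => x * f x).
  by move=> cf x; apply: cvgM; [exact: cvg_id|exact: cf].
have contZ k (f : R -> R) : continuous f -> continuous (fun x : R => k * f x).
  by move=> cf x; apply: cvgM; [exact: cvg_cst|exact: cf].
have contD (f g : R -> R) : continuous f -> continuous g -> continuous (fun x : R => f x + g x).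
  by move=> cf cg x; apply: cvgD; [exact: cf|exact: cg].
have cg : c != 0 by rewrite gt_eqF.
split.
- have [J JE] := int_comb xi (- (2 * c)) (2 * c * y) _ _ _ Ic Ms Is.
  have : Rintegral leb setT (fun x => xi * (cos (x * xi) * w x) +
     - (2 * c) * (x * sin (x * xi) * w x) + 2 * c * y * (sin (x * xi) * w x)) = 0.
    apply: (@Rintegral_derive_eq0 (fun x => sin (x * xi) * w x)) => //.
    + move=> x; apply: trigger_derive; rewrite /GRing.scale /=.
      by rewrite -/w; ring.
    + apply: (contD); last by apply: contZ; exact: contw.
      apply: contD; apply: contZ; first exact: contw.
      by apply: (contw (fun x => x * sin (x * xi))); exact: contx.
    + by apply: (gauss_weight_cvg0 (h := fun x => sin (x * xi)) y c0 _ n1) => z; exact: sin_max.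
    + by apply: (gauss_weight_cvg0 (h := fun x => sin (x * xi)) y c0 _ n2) => z; exact: sin_max.
  rewrite JE -/(gauss_cos c y xi) -/(gauss_sin c y xi) => h.
  rewrite (_ : Rintegral leb setT (fun x => x * - sin (x * xi) * gauss_weight c y x) =
    (- 1) * Rintegral leb setT (fun x => x * sin (x * xi) * gauss_weight c y x)); last first.
    by rewrite -RintegralZl//; apply: eq_Rintegral => x _; ring.
  set T := Rintegral _ _ _ in h *.
  have -> : T = (2 * c)^-1 * (2 * c * T) by field.
  have -> : 2 * c * T = xi * gauss_cos c y xi + 2 * c * y * gauss_sin c y xi by lra.
  by field.
- have [J JE] := int_comb (- xi) (- (2 * c)) (2 * c * y) _ _ _ Is Mc Ic.
  have : Rintegral leb setT (fun x => - xi * (sin (x * xi) * w x) +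
     - (2 * c) * (x * cos (x * xi) * w x) + 2 * c * y * (cos (x * xi) * w x)) = 0.
    apply: (@Rintegral_derive_eq0 (fun x => cos (x * xi) * w x)) => //.
    + move=> x; apply: trigger_derive; rewrite /GRing.scale /=.
      by rewrite -/w; ring.
    + apply: (contD); last by apply: contZ; exact: contw.
      apply: contD; apply: contZ; first exact: contw.
      by apply: (contw (fun x => x * cos (x * xi))); exact: contx.
    + by apply: (gauss_weight_cvg0 (h := fun x => cos (x * xi)) y c0 _ n1) => z; exact: cos_max.
    + by apply: (gauss_weight_cvg0 (h := fun x => cos (x * xi)) y c0 _ n2) => z; exact: cos_max.
  rewrite JE -/(gauss_cos c y xi) -/(gauss_sin c y xi) => h.
  set T := Rintegral _ _ _ in h *.
  have -> : T = (2 * c)^-1 * (2 * c * T) by field.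
  have -> : 2 * c * T = - xi * gauss_sin c y xi + 2 * c * y * gauss_cos c y xi by lra.
  by field.
Qed.

(** Differentiating under the integral and integrating by parts, the cosine and
    sine transforms solve the linear system
    [C' = - y S - (xi / 2c) C], [S' = y C - (xi / 2c) S]. Hence the vector
    [(C, S)] rotated back by the angle [y xi] and multiplied by
    [exp(xi^2 / 4c)] is constant, and its value at [0] is the Gaussian
    integral. *)
Lemma gauss_fourier1 (c y xi : R) : 0 < c ->
  gauss_cos c y xi = Num.sqrt (pi / c) * expR (- (xi ^+ 2 / (4 * c))) * cos (y * xi) /\
  gauss_sin c y xi = Num.sqrt (pi / c) * expR (- (xi ^+ 2 / (4 * c))) * sin (y * xi).
Proof.
move=> c0; have cg : c != 0 by rewrite gt_eqF.
have dC (z : R) : is_derive z 1 (gauss_cos c y) (- (y * gauss_sin c y z + z / (2 * c) * gauss_cos c y z)).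
  rewrite -(gauss_cos_sin_by_parts y z c0).1.
  apply: (@is_derive_gauss_under _ (fun x => - sin x)) => // x.
  - by rewrite cos_max.
  - by rewrite normrN sin_max.
have dS (z : R) : is_derive z 1 (gauss_sin c y) (y * gauss_cos c y z - z / (2 * c) * gauss_sin c y z).
  rewrite -(gauss_cos_sin_by_parts y z c0).2.
  apply: (@is_derive_gauss_under _ cos) => // x.
  - by rewrite sin_max.
  - by rewrite cos_max.
have dcy z := is_derive_cos_lin y z.
have dsy z := is_derive_sin_lin y z.
pose e z := expR (z ^+ 2 / (4 * c)).
have de (z : R) : is_derive z 1 e (z / (2 * c) * e z).
  rewrite /e; apply: trigger_derive; rewrite /GRing.scale /=; field => //.
(* the real and imaginary parts of [(C + iS) exp(-i y z) exp(z^2 / 4c)] *)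
pose P z := (gauss_cos c y z * cos (z * y) + gauss_sin c y z * sin (z * y)) * e z.
pose Q z := (gauss_sin c y z * cos (z * y) - gauss_cos c y z * sin (z * y)) * e z.
have PE : P xi = P 0.
  apply: is_derive_0_is_cst => z; rewrite /P; apply: trigger_derive.
  rewrite /GRing.scale /=; ring.
have QE : Q xi = Q 0.
  apply: is_derive_0_is_cst => z; rewrite /Q; apply: trigger_derive.
  rewrite /GRing.scale /=; ring.
have C0 : gauss_cos c y 0 = Num.sqrt (pi / c).
  rewrite /gauss_cos /Rintegral; under eq_integral do rewrite mulr0 cos0 mul1r.
  by rewrite integral_gauss_weight.
have S0 : gauss_sin c y 0 = 0.
  rewrite /gauss_sin; under eq_Rintegral do rewrite mulr0 sin0 mul0r.
  by rewrite Rintegral_cst// mul0r.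
have P0 : P 0 = Num.sqrt (pi / c).
  by rewrite /P /e C0 S0 expr0n/= !mul0r ?sin0 ?cos0 expR0; ring.
have Q0 : Q 0 = 0.
  by rewrite /Q /e C0 S0 expr0n/= !mul0r ?sin0 ?cos0 expR0; ring.
move: PE QE; rewrite P0 Q0 /P /Q /e expRN !(mulrC xi y).
have /gt_eqF := expR_gt0 (xi ^+ 2 / (4 * c)).
set E := expR _; set k := Num.sqrt _ => En h1 h2.
have := cos2Dsin2 (y * xi).
set C := gauss_cos _ _ _ in h1 h2 *; set S := gauss_sin _ _ _ in h1 h2 *.
set u := cos _ in h1 h2 *; set v := sin _ in h1 h2 * => uv.
have En0 : E != 0 by rewrite En.
have {}h1 : C * u + S * v = k * E^-1 by rewrite -h1 mulfK.
have {}h2 : S * u - C * v = 0.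
  by move/eqP: h2; rewrite mulf_eq0 (negbTE En0) orbF => /eqP.
rewrite -h1; split.
- transitivity (C * (u ^+ 2 + v ^+ 2) + v * (S * u - C * v)); first by rewrite uv h2; ring.
  by ring.
- transitivity (S * (u ^+ 2 + v ^+ 2) - u * (S * u - C * v)); first by rewrite uv h2; ring.
  by ring.
Qed.

End gauss1.

(** * Lebesgue measure and Gaussians in higher dimension *)

Section rV.
Context {R : realType}.
Local Notation leb := (@lebesgue_measure R).

Lemma cons_rV0 n (t : R) (v : 'rV[R]_n) : cons_rV (t, v) ord0 ord0 = t.
Proof.
rewrite /cons_rV; have -> : (ord0 : 'I_(1 + n)) = lshift n ord0 by exact: val_inj.
by rewrite [LHS](row_mxEl _ _ ord0) mxE eqxx.
Qed.

Lemma cons_rVS n (t : R) (v : 'rV[R]_n) i :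
  cons_rV (t, v) ord0 (lift ord0 i) = v ord0 i.
Proof.
rewrite /cons_rV; have -> : lift (ord0 : 'I_(1 + n)) i = rshift 1 i by exact: val_inj.
exact: row_mxEr.
Qed.

(** A name for Lebesgue measure that can carry the sigma-finiteness instance
    needed by the theorems of Fubini and Tonelli. *)
Definition lebd n : set 'rV[R]_n -> \bar R := lebesgue_rV R n.
Arguments lebd : clear implicits.

HB.instance Definition _ n := Measure.copy (lebd n) (lebesgue_rV R n).

Definition cube n (k : nat) : set 'rV[R]_n :=
  [set x | forall i, `|x ord0 i| <= k%:R].
Arguments cube : clear implicits.

Lemma measurable_cube n k : measurable (@cube n k).
Proof.
have -> : cube n k = \bigcap_(i : 'I_n) [set x | `|x ord0 i| <= k%:R].
  by apply/seteqP; split => [x h i _|x h i]; [exact: h|exact: (h i I)].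
rewrite -[X in measurable X]setCK setC_bigcap; apply: measurableC.
apply: countable_bigcupT_measurable => // i; apply: measurableC.
have mi := @measurable_coord_rV R n i.
have := mi measurableT `[- k%:R, k%:R]%classic (measurable_itv _).
by rewrite setTI; congr measurable; apply/seteqP; split => x /=; rewrite in_itv/= ler_norml.
Qed.

Lemma lebd_cube_lty n k : (lebd n (cube n k) < +oo)%E.
Proof.
elim: n => [|n ih]; rewrite /lebd /=.
  by rewrite diracE; case: (_ \in _); rewrite ltry.
rewrite /pushforward.
have -> : @cons_rV R n @^-1` cube n.+1 k = `[- k%:R, k%:R]%classic `*` cube n k.
  apply/seteqP; split => [[t v] /= h|[t v] /= [h1 h2] i].
    split => /=; first by have := h ord0; rewrite cons_rV0 in_itv/= ler_norml.
    by move=> i; have := h (lift ord0 i); rewrite cons_rVS.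
  case: (unliftP ord0 i) => [j ->|->]; first by rewrite cons_rVS.
  by move: h1; rewrite cons_rV0 /= in_itv/= ler_norml.
rewrite product_measure2E//; last exact: measurable_cube.
apply: lte_mul_pinfty => //.
suff : lebesgue_measure (`[- k%:R, k%:R]%classic : set R) \is a fin_num by [].
by rewrite lebesgue_measure_itv/=; case: ifP.
Qed.

Lemma lebd_sigma_finite n : sigma_finite setT (lebd n).
Proof.
exists (cube n).
  apply/seteqP; split => // x _.
  exists (Num.truncn (\sum_i `|x ord0 i|)).+1 => //= i.
  apply: (le_trans _ (ltW (truncnS_gt _))).
  by rewrite (bigD1 i)//= lerDl sumr_ge0.
by move=> k; split; [exact: measurable_cube|exact: lebd_cube_lty].
Qed.

HB.instance Definition _ n := @Measure_isSigmaFinite.Build _ _ _ (lebd n) (lebd_sigma_finite n).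

(** The recursion defining Lebesgue measure integrates over the vector last;
    the theorem of Tonelli identifies the two iterated products. *)
Lemma ge0_integral_lebdS n (f : 'rV[R]_n.+1 -> \bar R) :
  measurable_fun [set: 'rV[R]_n.+1] f -> (forall x, 0 <= f x)%E ->
  (\int[lebd n.+1]_x f x = \int[leb]_t \int[lebd n]_v f (cons_rV (t, v)))%E.
Proof.
move=> mf f0.
transitivity (\int[pushforward (leb \x^ lebd n) (@cons_rV R n)]_x f x)%E; first by [].
rewrite ge0_integral_pushforward//; last exact: measurable_cons_rV.
rewrite preimage_setT.
transitivity (\int[leb \x lebd n]_x (f \o @cons_rV R n) x)%E.
  apply: eq_measure_integral => A mA _; apply/esym.
  by apply: product_measure_unique => // B C mB mC/=; rewrite product_measure2E.
rewrite fubini_tonelli1//; last by move=> x; exact: f0.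
by apply: measurableT_comp => //; exact: measurable_cons_rV.
Qed.

Lemma integrable_lebd_prod n (u : R -> R) (w : 'rV[R]_n -> R) (f : 'rV[R]_n.+1 -> R) :
  leb.-integrable setT (EFin \o u) -> (lebd n).-integrable setT (EFin \o w) ->
  measurable_fun setT f ->
  (forall t v, f (cons_rV (t, v)) = u t * w v) ->
  (lebd n.+1).-integrable setT (EFin \o f) /\
  Rintegral (lebd n.+1) setT f = Rintegral leb setT u * Rintegral (lebd n) setT w.
Proof.
move=> iu iw mf fE.
have mu : measurable_fun setT (EFin \o u) := measurable_int _ iu.
have mw : measurable_fun setT (EFin \o w) := measurable_int _ iw.
have fin_u : (\int[leb]_t `|(u t)%:E| < +oo)%E by case/integrableP: iu.
have fin_w : (\int[lebd n]_t `|(w t)%:E| < +oo)%E by case/integrableP: iw.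
have absE : (\int[lebd n.+1]_x `|(f x)%:E| =
    \int[leb]_t `|(u t)%:E| * \int[lebd n]_t `|(w t)%:E|)%E.
  rewrite ge0_integral_lebdS//; last by do 2 apply: measurableT_comp => //.
  under eq_integral => t _.
    under eq_integral do rewrite fE EFinM abseM.
    rewrite ge0_integralZl//; last exact: measurableT_comp.
    over.
  by rewrite ge0_integralZr//; [apply: measurableT_comp|apply: integral_ge0].
have i_f : (lebd n.+1).-integrable setT (EFin \o f).
  apply/integrableP; split; first exact: measurableT_comp.
  rewrite absE; apply: lte_mul_pinfty => //.
  - exact: integral_ge0.
  - by rewrite ge0_fin_numE// integral_ge0.
split=> //.
have mc : measurable_fun setT ((EFin \o f) \o @cons_rV R n).
  by apply: measurableT_comp; [exact: measurableT_comp|exact: measurable_cons_rV].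
have ifc : (leb \x lebd n)%E.-integrable setT ((EFin \o f) \o @cons_rV R n).
  apply/integrable12ltyP => //=.
  move/integrableP : i_f => [_]; rewrite ge0_integral_lebdS//.
  by do 2 apply: measurableT_comp => //.
rewrite /Rintegral.
transitivity (fine (\int[leb]_t \int[lebd n]_v (f (cons_rV (t, v)))%:E)%E).
  congr fine.
  rewrite (integral12_prod_meas2 ifc).
  transitivity (\int[pushforward (leb \x^ lebd n) (@cons_rV R n)]_x (f x)%:E)%E; first by [].
  rewrite integral_pushforward ?preimage_setT//.
  - exact: measurable_cons_rV.
  - exact: measurableT_comp.
  - apply/integrableP; split=> //; case/integrableP: ifc => _; congr (_ < _)%E.
    apply: eq_measure_integral => A mA _.
    by apply: product_measure_unique => // B C mB mC/=; rewrite product_measure2E.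
transitivity (fine (\int[leb]_t ((u t)%:E * (Rintegral (lebd n) setT w)%:E))%E).
  congr fine; apply: eq_integral => t _.
  under eq_integral do rewrite fE EFinM.
  by rewrite integralZl// /Rintegral fineK// integrable_fin_num.
by rewrite integralZr//= fineM ?integrable_fin_num.
Qed.

Lemma dotp_cons n (t s : R) (v w : 'rV[R]_n) :
  dotp (cons_rV (t, v)) (cons_rV (s, w)) = t * s + dotp v w.
Proof.
rewrite /dotp big_ord_recl !cons_rV0; congr (_ + _).
by apply: eq_bigr => i _; rewrite !cons_rVS.
Qed.

Lemma cons_rV_surj n (x : 'rV[R]_n.+1) : exists t v, x = cons_rV (t, v).
Proof.
exists (x ord0 ord0), (\row_i x ord0 (lift ord0 i)).
apply/rowP => i; case: (unliftP ord0 i) => [j ->|->]; last by rewrite cons_rV0.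
by rewrite cons_rVS mxE.
Qed.

Lemma cons_rVB n (t s : R) (v w : 'rV[R]_n) :
  cons_rV (t, v) - cons_rV (s, w) = cons_rV (t - s, v - w).
Proof.
have E m (x y : 'rV[R]_m) i : (x - y) ord0 i = x ord0 i - y ord0 i by rewrite !mxE.
apply/rowP => i; case: (unliftP ord0 i) => [j ->|->].
  by rewrite E !cons_rVS E.
by rewrite E !cons_rV0.
Qed.

Lemma measurable_dotp d (T : measurableType d) n (f g : T -> 'rV[R]_n) :
  measurable_fun setT f -> measurable_fun setT g ->
  measurable_fun setT (fun x => dotp (f x) (g x)).
Proof.
move=> mf mg; apply: measurable_sum => i.
by apply: measurable_funM; exact: (measurableT_comp (measurable_coord_rV i)).
Qed.

Lemma measurable_rVB d (T : measurableType d) n (f g : T -> 'rV[R]_n) :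
  measurable_fun setT f -> measurable_fun setT g ->
  measurable_fun setT (fun x => f x - g x).
Proof.
move=> mf mg; apply: measurable_fun_rV => i.
rewrite (_ : (fun x => _) = fun x => f x ord0 i - g x ord0 i).
  by apply: measurable_funB; exact: (measurableT_comp (measurable_coord_rV i)).
by apply/funext => x; rewrite !mxE.
Qed.

Definition sqnorm n (x : 'rV[R]_n) : R := dotp x x.

Lemma sqnorm_ge0 n (x : 'rV[R]_n) : 0 <= sqnorm x.
Proof. by apply: sumr_ge0 => i _; rewrite -expr2 sqr_ge0. Qed.

Definition gaussd n c (y x : 'rV[R]_n) : R := expR (- c * sqnorm (x - y)).

Lemma measurable_gaussd n c (y : 'rV[R]_n) : measurable_fun setT (gaussd c y).
Proof.
apply: measurableT_comp => //; apply: measurable_funM => //.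
by apply: measurable_dotp; exact: measurable_rVB.
Qed.

Lemma gaussd_cons n c t s (v w : 'rV[R]_n) :
  gaussd c (cons_rV (s, w)) (cons_rV (t, v)) = gauss_weight c s t * gaussd c w v.
Proof.
by rewrite /gaussd /gauss_weight -expRD cons_rVB /sqnorm dotp_cons; congr expR; ring.
Qed.

(** Induction on the dimension: the Gaussian is a product over coordinates and
    the addition formulas expand the trigonometric factor into products of
    functions of the first coordinate and of the remaining vector. The
    statements for [cos] and [sin] are needed together. *)
Lemma gauss_fourier n c (y xi : 'rV[R]_n) : 0 < c ->
  let k := Num.sqrt (pi / c) ^+ n * expR (- (sqnorm xi / (4 * c))) in
  [/\ (lebd n).-integrable setT (fun x => (cos (dotp x xi) * gaussd c y x)%:E),
      (lebd n).-integrable setT (fun x => (sin (dotp x xi) * gaussd c y x)%:E),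
      Rintegral (lebd n) setT (fun x => cos (dotp x xi) * gaussd c y x) =
        k * cos (dotp y xi) &
      Rintegral (lebd n) setT (fun x => sin (dotp x xi) * gaussd c y x) =
        k * sin (dotp y xi)].
Proof.
move=> c0.
have mg m (z : 'rV[R]_m) := measurable_gaussd c z.
have mct m (z : 'rV[R]_m) : measurable_fun setT (fun x : 'rV[R]_m => cos (dotp x z)).
  apply: (measurableT_comp (continuous_measurable_fun (@continuous_cos R))).
  exact: measurable_dotp.
have mst m (z : 'rV[R]_m) : measurable_fun setT (fun x : 'rV[R]_m => sin (dotp x z)).
  apply: (measurableT_comp (continuous_measurable_fun (@continuous_sin R))).
  exact: measurable_dotp.
elim: n y xi => [|n ih] y xi.
  have E0 (a b : 'rV[R]_0) : dotp a b = 0 by rewrite /dotp big_ord0.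
  have leb0T : lebd 0 setT = 1%E by exact: diracT.
  have int1 (r : R) : (lebd 0).-integrable setT (fun=> r%:E).
    apply/integrableP; split => //.
    apply: (@le_lt_trans _ _ (`|r|%:E * lebd 0 setT)%E).
      by rewrite -integral_cst.
    by rewrite leb0T mule1 ltry.
  have R1 (r : R) : Rintegral (lebd 0) setT (fun=> r) = r.
    by rewrite Rintegral_cst// [X in fine X]leb0T mulr1.
  rewrite /gaussd /sqnorm !E0 cos0 sin0 expr0 mulr0 mul0r oppr0 expR0.
  split.
  - by under eq_fun do rewrite !E0 cos0 mulr0 expR0 mul1r.
  - by under eq_fun do rewrite !E0 sin0 mul0r.
  - by under eq_Rintegral do rewrite !E0 cos0 mulr0 expR0 mul1r; rewrite R1 !mulr1.
  - by under eq_Rintegral do rewrite !E0 sin0 mul0r; rewrite R1 ?mulr0.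
have [s [w ->]] := cons_rV_surj y.
have [eta [zeta ->]] := cons_rV_surj xi.
have [ic is_ cE sE] := ih w zeta.
have [gc gs] := gauss_fourier1 s eta c0.
have i1c := @integrable_bounded_gauss R _ c s c0 (measurable_cos_lin eta) (fun x => cos_max _).
have i1s := @integrable_bounded_gauss R _ c s c0 (measurable_sin_lin eta) (fun x => sin_max _).
pose u1 t := cos (t * eta) * gauss_weight c s t.
pose u2 t := sin (t * eta) * gauss_weight c s t.
pose w1 v := cos (dotp v zeta) * gaussd c w v.
pose w2 v := sin (dotp v zeta) * gaussd c w v.
pose hd (x : 'rV[R]_n.+1) : R := x ord0 ord0.
pose tl (x : 'rV[R]_n.+1) : 'rV[R]_n := \row_i x ord0 (lift ord0 i).
have hdE t v : hd (cons_rV (t, v)) = t by rewrite /hd cons_rV0.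
have tlE t v : tl (cons_rV (t, v)) = v.
  by apply/rowP => i; rewrite mxE cons_rVS.
have mhd : measurable_fun setT hd by exact: measurable_coord_rV.
have mtl : measurable_fun setT tl.
  apply: measurable_fun_rV => i; under eq_fun do rewrite mxE.
  exact: measurable_coord_rV.
have mu1 : measurable_fun setT u1.
  by apply: measurable_funM; [exact: measurable_cos_lin|exact: measurable_gauss_weight].
have mu2 : measurable_fun setT u2.
  by apply: measurable_funM; [exact: measurable_sin_lin|exact: measurable_gauss_weight].
have mw1 : measurable_fun setT w1 by apply: measurable_funM; [exact: mct|exact: mg].
have mw2 : measurable_fun setT w2 by apply: measurable_funM; [exact: mst|exact: mg].
have comb u v :
  leb.-integrable setT (EFin \o u) -> (lebd n).-integrable setT (EFin \o v) ->
  measurable_fun setT u -> measurable_fun setT v ->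
  (lebd n.+1).-integrable setT (EFin \o (fun x => u (hd x) * v (tl x))) /\
  Rintegral (lebd n.+1) setT (fun x => u (hd x) * v (tl x)) =
    Rintegral leb setT u * Rintegral (lebd n) setT v.
  move=> iu iv mu mv; apply: (integrable_lebd_prod iu iv).
    by apply: measurable_funM; apply: measurableT_comp.
  by move=> t x; rewrite hdE tlE.
have [i11 E11] := comb _ _ i1c ic mu1 mw1.
have [i12 E12] := comb _ _ i1c is_ mu1 mw2.
have [i21 E21] := comb _ _ i1s ic mu2 mw1.
have [i22 E22] := comb _ _ i1s is_ mu2 mw2.
have cosE x : cos (dotp x (cons_rV (eta, zeta))) * gaussd c (cons_rV (s, w)) x =
    u1 (hd x) * w1 (tl x) - u2 (hd x) * w2 (tl x).
  have [t [v ->]] := cons_rV_surj x.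
  rewrite hdE tlE gaussd_cons dotp_cons cosD /u1 /u2 /w1 /w2; ring.
have sinE x : sin (dotp x (cons_rV (eta, zeta))) * gaussd c (cons_rV (s, w)) x =
    u2 (hd x) * w1 (tl x) + u1 (hd x) * w2 (tl x).
  have [t [v ->]] := cons_rV_surj x.
  rewrite hdE tlE gaussd_cons dotp_cons sinD /u1 /u2 /w1 /w2; ring.
have kE : Num.sqrt (pi / c) ^+ n.+1 * expR (- (sqnorm (cons_rV (eta, zeta)) / (4 * c))) =
  (Num.sqrt (pi / c) * expR (- (eta ^+ 2 / (4 * c)))) *
  (Num.sqrt (pi / c) ^+ n * expR (- (sqnorm zeta / (4 * c)))).
  rewrite exprS [X in _ * expR X = _](_ : _ =
    - (eta ^+ 2 / (4 * c)) + - (sqnorm zeta / (4 * c))).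
    by rewrite expRD; ring.
  by rewrite /sqnorm dotp_cons -expr2; field; rewrite gt_eqF.
rewrite /= kE dotp_cons; split.
- under eq_fun do rewrite cosE.
  exact: (integrableB measurableT i11 i22).
- under eq_fun do rewrite sinE.
  exact: (integrableD measurableT i21 i12).
- under eq_Rintegral do rewrite cosE.
  rewrite RintegralB// E11 E22 -/(gauss_cos c s eta) -/(gauss_sin c s eta) gc gs.
  by rewrite cE sE cosD; ring.
- under eq_Rintegral do rewrite sinE.
  rewrite RintegralD// E21 E12 -/(gauss_cos c s eta) -/(gauss_sin c s eta) gc gs.
  by rewrite cE sE sinD; ring.
Qed.

End rV.
Arguments lebd {R} n _.

(** * Convolution semigroup of heat and Bessel kernels *)

Section param.
Context {R : realType}.
Local Notation leb := (@lebesgue_measure R).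

Lemma measurable_lebesgue_integral d (T : measurableType d) (f : R * T -> \bar R) :
  measurable_fun [set: R * T] f -> (forall x, 0 <= f x)%E ->
  measurable_fun [set: T] (fun y => \int[leb]_x f (x, y))%E.
Proof.
move=> mf f0.
exact: (@measurable_fun_fubini_tonelli_G _ _ (measurableTypeR R) T R leb f mf f0).
Qed.

Lemma measurable_lebd_integral n d (T : measurableType d) (f : T * 'rV[R]_n -> \bar R) :
  measurable_fun setT f -> (forall x, 0 <= f x)%E ->
  measurable_fun [set: T] (fun y => \int[lebd n]_x f (y, x))%E.
Proof.
move=> mf f0.
exact: (@measurable_fun_fubini_tonelli_F _ _ T _ R (lebd n) f mf f0).
Qed.
End param.

Section conv.
Context {R : realType} (n : nat).
Local Notation leb := (@lebesgue_measure R).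
Local Notation V := 'rV[R]_n.

(** The heat kernel at time [expR u], without the factor [(4 pi)^(-n/2)]. *)
Definition heat (u : R) (x : V) : R :=
  expR (- (n%:R / 2) * u - sqnorm x / 4 * expR (- u)).

Lemma measurable_sqnorm : measurable_fun setT (@sqnorm R n).
Proof. exact: measurable_dotp. Qed.

Lemma measurable_heat : measurable_fun setT (fun p : R * V => heat p.1 p.2).
Proof.
apply: measurableT_comp => //; apply: measurable_funB.
  exact: measurable_funM.
apply: measurable_funM.
  apply: measurable_funM => //.
  exact: (measurableT_comp measurable_sqnorm).
by apply: measurableT_comp => //; exact: measurableT_comp.
Qed.

(** The product of two Gaussians in [y] is a Gaussian in [y] with a shifted
    centre, whose variances combine to [S + T] in the remaining factor. *)
Lemma sqnorm_complete_square (S T : R) (x y : V) : 0 < S -> 0 < T ->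
  sqnorm (x - y) / S + sqnorm y / T =
  (S + T) / (S * T) * sqnorm (y - (T / (S + T)) *: x) + sqnorm x / (S + T).
Proof.
move=> S0 T0; rewrite /sqnorm /dotp !mulr_suml mulr_sumr -!big_split /=.
apply: eq_bigr => i _; rewrite !mxE; field.
by rewrite !gt_eqF// addr_gt0.
Qed.

Lemma integral_gaussd c (y : V) : 0 < c ->
  (\int[lebd n]_x (gaussd c y x)%:E = (Num.sqrt (pi / c) ^+ n)%:E)%E.
Proof.
move=> c0; have [ic _ + _] := @gauss_fourier R n c y 0 c0.
have d0 (z : V) : dotp z 0 = 0.
  by apply: big1 => i _; rewrite mxE mulr0.
have s0 : sqnorm (0 : V) = 0 by exact: d0.
under eq_Rintegral do rewrite d0 cos0 mul1r.
rewrite d0 s0 mul0r oppr0 expR0 cos0 !mulr1 /Rintegral => <-.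
rewrite fineK//; move: ic.
have -> : (fun x : V => (cos (dotp x 0) * gaussd c y x)%:E) = (fun x => (gaussd c y x)%:E).
  by apply/funext => x; rewrite d0 cos0 mul1r.
by move=> ic; exact: integrable_fin_num.
Qed.

(** The semigroup law of the heat kernel: the times [expR s] and [expR t]
    add. *)
Lemma heat_conv s t (x : V) :
  (\int[lebd n]_y (heat s (x - y) * heat t y)%:E =
   (Num.sqrt (4 * pi) ^+ n * heat (ln (expR s + expR t)) x)%:E)%E.
Proof.
have S0 := expR_gt0 s; have T0 := expR_gt0 t.
have ST0 : 0 < expR s + expR t by rewrite addr_gt0.
set L := ln _.
have eL : expR L = expR s + expR t by rewrite lnK.
pose c := (expR s + expR t) / (4 * (expR s * expR t)).
have c0 : 0 < c by rewrite divr_gt0// !mulr_gt0.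
pose z := (expR t / (expR s + expR t)) *: x.
pose k := expR (- (n%:R / 2) * (s + t) - sqnorm x / 4 * expR (- L)).
have E y : heat s (x - y) * heat t y = k * gaussd c z y.
  rewrite /heat /gaussd /k -!expRD; congr expR.
  have := @sqnorm_complete_square _ _ x y S0 T0; rewrite -/z.
  rewrite !expRN eL => h.
  transitivity (- (n%:R / 2) * (s + t) - (sqnorm (x - y) / expR s + sqnorm y / expR t) / 4).
    by ring.
  rewrite h /c; field.
  by rewrite !gt_eqF.
under eq_integral do rewrite E EFinM.
rewrite ge0_integralZl_EFin ?expR_ge0//; last first.
  by apply: measurableT_comp => //; exact: measurable_gaussd.
  by move=> y _; rewrite lee_fin expR_ge0.
rewrite integral_gaussd// -EFinM; congr EFin.
have -> : pi / c = (4 * pi) * expR (s + t - L).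
  rewrite expRD expRN eL expRD /c; field.
  by rewrite !gt_eqF.
rewrite sqrtrM ?mulr_ge0 ?pi_ge0// exprMn mulrCA; congr (_ * _).
have -> : Num.sqrt (expR (s + t - L)) = expR ((s + t - L) / 2).
  have -> : expR (s + t - L) = expR ((s + t - L) / 2) ^+ 2.
    by rewrite -expRM_natr; congr expR; field.
  by rewrite sqrtr_sqr ger0_norm ?expR_ge0.
rewrite -expRM_natr /k /heat -expRD; congr expR; by field.
Qed.

(** The integral of the heat kernel against [t^(a/2) exp(-m t) dt/t], which is
    a multiple of the kernel of the operator of order [-a] with symbol
    [(m + |xi|^2)^(-a/2)]. *)
Definition bessel (a m : R) (x : V) : \bar R :=
  macdonald ((a - n%:R) / 2) m (sqnorm x / 4).

Definition bessel_density (a m u : R) (x : V) : R :=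
  expR (a / 2 * u - m * expR u) * heat u x.

Lemma bessel_densityE a m u x : bessel_density a m u x =
  expR (macdonald_exponent ((a - n%:R) / 2) m (sqnorm x / 4) u).
Proof.
rewrite /bessel_density /heat -expRD /macdonald_exponent; congr expR; by field.
Qed.

Lemma bessel_density_ge0 a m u x : 0 <= bessel_density a m u x.
Proof. by rewrite bessel_densityE expR_ge0. Qed.

Lemma besselE a m x :
  bessel a m x = (\int[leb]_u (bessel_density a m u x)%:E)%E.
Proof. by apply: eq_integral => u _; rewrite bessel_densityE. Qed.

Lemma measurable_bessel_density a m :
  measurable_fun setT (fun p : R * V => (bessel_density a m p.1 p.2)%:E).
Proof.
apply: measurableT_comp => //; apply: measurable_funM; last exact: measurable_heat.
apply: measurableT_comp => //; apply: measurable_funB; first exact: measurable_funM.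
by apply: measurable_funM => //; exact: measurableT_comp.
Qed.

Lemma measurable_bessel a m : measurable_fun setT (bessel a m).
Proof.
have := measurable_lebesgue_integral (@measurable_bessel_density a m)
  (fun p => bessel_density_ge0 a m p.1 p.2).
by apply: eq_measurable_fun => x _; rewrite besselE.
Qed.

Lemma bessel_ge0 a m x : (0 <= bessel a m x)%E.
Proof. exact: macdonald_ge0. Qed.

(** By Tonelli the convolution is a double mixture of convolutions of heat
    kernels, which depend on the two times through their sum only; so does the
    factor [exp(-m t)], and [beta_mixture] applies. *)
Lemma bessel_conv a m x :
  (econv (bessel a m) (bessel a m) x =
   (Num.sqrt (4 * pi) ^+ n)%:E * beta_integral (a / 2) * bessel (2 * a) m x)%E.
Proof.
have mF := @measurable_bessel_density a m.
have mFs s : measurable_fun setT (fun y : V => (bessel_density a m s y)%:E).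
  exact: (measurableT_comp mF (pair1_measurable s)).
have msub : measurable_fun setT (fun y : V => x - y) by exact: measurable_rVB.
have mFt y : measurable_fun setT (fun t : R => (bessel_density a m t y)%:E).
  exact: (measurableT_comp mF (pair2_measurable y)).
have F0 := bessel_density_ge0 a m.
rewrite /econv.
transitivity (\int[lebd n]_y \int[leb]_s
    ((bessel_density a m s (x - y))%:E * bessel a m y))%E.
  apply: eq_integral => y _; rewrite besselE ge0_integralZr//.
  - exact: mFt.
  - by move=> s _; rewrite lee_fin.
  - exact: bessel_ge0.
rewrite -(lebesgue_tonelli (lebd n) (f := fun p : R * V =>
    ((bessel_density a m p.1 (x - p.2))%:E * bessel a m p.2)%E)); last 2 first.
- apply: emeasurable_funM.
    apply: (measurableT_comp mF (g := fun p : R * V => (p.1, x - p.2))).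
    by apply: measurable_fun_pair => //; exact: measurable_rVB.
  by apply: measurableT_comp => //; exact: measurable_bessel.
- by move=> p; rewrite mule_ge0 ?bessel_ge0 ?lee_fin.
transitivity (\int[leb]_s \int[leb]_t \int[lebd n]_y
    ((bessel_density a m s (x - y))%:E * (bessel_density a m t y)%:E))%E.
  apply: eq_integral => s _.
  rewrite (lebesgue_tonelli (lebd n) (f := fun p : R * V =>
    ((bessel_density a m s (x - p.2))%:E * (bessel_density a m p.1 p.2)%:E)%E)); last 2 first.
  - apply: emeasurable_funM => //.
    apply: (measurableT_comp (mFs s)).
    exact: measurable_rVB.
  - by move=> p; rewrite mule_ge0 ?lee_fin.
  apply: eq_integral => y _; rewrite besselE /=; apply/esym.
  apply: ge0_integralZl_EFin => //; last exact: mFt.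
  by move=> t _; rewrite lee_fin.
pose k := Num.sqrt (4 * pi : R) ^+ n.
have k0 : 0 <= k by rewrite exprn_ge0.
pose Phi u := (expR (- m * expR u) * heat u x)%:E.
have Phi0 u : (0 <= Phi u)%E by rewrite lee_fin mulr_ge0 ?expR_ge0.
have mPhi : measurable_fun [set: R] Phi.
  apply: measurableT_comp => //; apply: measurable_funM.
    by apply: measurableT_comp => //; apply: measurable_funM.
  exact: (measurableT_comp measurable_heat (pair2_measurable x)).
have inner s t : (\int[lebd n]_y ((bessel_density a m s (x - y))%:E *
     (bessel_density a m t y)%:E) =
   k%:E * ((expR (a / 2 * s + a / 2 * t))%:E * Phi (ln (expR s + expR t))))%E.
  pose c := expR (a / 2 * s - m * expR s) * expR (a / 2 * t - m * expR t).
  transitivity (\int[lebd n]_y (c%:E * (heat s (x - y) * heat t y)%:E))%E.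
    apply: eq_integral => y _; rewrite -!EFinM; congr EFin.
    by rewrite /bessel_density /c; ring.
  rewrite ge0_integralZl_EFin ?heat_conv//; last 3 first.
  - by move=> y _; rewrite lee_fin mulr_ge0 ?expR_ge0.
  - apply: measurableT_comp => //; apply: measurable_funM.
      have ms : measurable_fun setT (heat s).
        exact: (measurableT_comp measurable_heat (pair1_measurable s)).
      exact: (measurableT_comp ms msub).
    exact: (measurableT_comp measurable_heat (pair1_measurable t)).
  - by rewrite mulr_ge0 ?expR_ge0.
  rewrite /Phi -!EFinM; congr EFin.
  rewrite lnK ?posrE ?addr_gt0 ?expR_gt0// /c -/k.
  rewrite mulrCA; congr (_ * _); rewrite mulrA; congr (_ * _).
  by rewrite -!expRD; congr expR; ring.
transitivity (k%:E * \int[leb]_s \int[leb]_t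
   ((expR (a / 2 * s + a / 2 * t))%:E * Phi (ln (expR s + expR t))))%E.
  have mG : measurable_fun setT (fun p : R * R => ((expR (a / 2 * p.1 + a / 2 * p.2))%:E *
      Phi (ln (expR p.1 + expR p.2)))%E).
    apply: emeasurable_funM.
      apply: measurableT_comp => //; apply: measurableT_comp => //.
      by apply: measurable_funD; exact: measurable_funM.
    apply: (measurableT_comp mPhi); apply: measurableT_comp => //.
    by apply: measurable_funD; exact: measurableT_comp.
  have G0 s t : (0 <= (expR (a / 2 * s + a / 2 * t))%:E *
      Phi (ln (expR s + expR t)))%E by rewrite mule_ge0// lee_fin expR_ge0.
  rewrite -ge0_integralZl_EFin//; last 2 first.
  - by move=> s _; apply: integral_ge0 => t _; exact: G0.
  - apply: (@measurable_fun_fubini_tonelli_F _ _ (measurableTypeR R) (measurableTypeR R) R leb _ mG).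
    by move=> p; exact: G0.
  apply: eq_integral => s _; under eq_integral do rewrite inner.
  rewrite ge0_integralZl_EFin//.
  exact: (measurableT_comp mG (pair1_measurable s)).
rewrite beta_mixture// muleA; congr (_ * _)%E.
apply: eq_integral => u _; rewrite /Phi -EFinM; congr EFin.
rewrite /heat -!expRD; congr expR; rewrite /macdonald_exponent; by field.
Qed.

Lemma measurable_econv (f g : V -> \bar R) :
  measurable_fun setT f -> measurable_fun setT g ->
  (forall x, 0 <= f x)%E -> (forall x, 0 <= g x)%E ->
  measurable_fun setT (econv f g).
Proof.
move=> mf mg f0 g0.
apply: (measurable_lebd_integral (f := fun p : V * V => (f (p.1 - p.2)%R * g p.2)%E)).
  apply: emeasurable_funM; last exact: measurableT_comp.
  by apply: measurableT_comp => //; exact: measurable_rVB.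
by move=> p; rewrite mule_ge0.
Qed.

Lemma econv_ge0 (f g : V -> \bar R) x :
  (forall x, 0 <= f x)%E -> (forall x, 0 <= g x)%E -> (0 <= econv f g x)%E.
Proof. by move=> f0 g0; apply: integral_ge0 => y _; rewrite mule_ge0. Qed.

Lemma econv_le (f g : V -> \bar R) (c : R) x :
  measurable_fun setT f -> measurable_fun setT g ->
  (forall x, 0 <= f x)%E -> (forall x, 0 <= g x)%E -> 0 <= c ->
  (forall x, f x <= c%:E * g x)%E ->
  (econv f f x <= (c ^+ 2)%:E * econv g g x)%E.
Proof.
move=> mf mg f0 g0 c0 fg.
have mfg (h : V -> \bar R) : measurable_fun setT h ->
    measurable_fun setT (fun y : V => h (x - y)%R * h y)%E.
  move=> mh; apply: emeasurable_funM => //; apply: measurableT_comp => //.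
  exact: measurable_rVB.
rewrite /econv -ge0_integralZl_EFin ?exprn_ge0//; last 2 first.
- by move=> y _; rewrite mule_ge0.
- exact: mfg.
apply: ge0_le_integral => //.
- by move=> y _; rewrite mule_ge0.
- exact: mfg.
- by apply: measurable_funeM; exact: mfg.
move=> y _; apply: (@le_trans _ _ ((c%:E * g (x - y)%R) * (c%:E * g y))%E).
  exact: lee_pmul.
by rewrite muleACA -EFinM expr2.
Qed.

End conv.

(** * The Euclidean norm and tempered measures *)

Section enorm.
Context {R : realType} {n : nat}.
Local Notation V := 'rV[R]_n.
Implicit Types x y : V.

Lemma enorm_ge0 x : 0 <= enorm x.
Proof. exact: sqrtr_ge0. Qed.

Lemma enorm_sqr x : enorm x ^+ 2 = sqnorm x.
Proof. by rewrite sqr_sqrtr// sqnorm_ge0. Qed.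

Lemma enorm_eq0 x : (enorm x == 0) = (x == 0).
Proof.
rewrite sqrtr_eq0; apply/idP/eqP => [|->]; last first.
  by rewrite /dotp big1// => i _; rewrite mxE mul0r.
move=> h; apply/rowP => i; rewrite mxE.
have /eqP : sqnorm x == 0 by rewrite eq_le h sqnorm_ge0.
move/eqP; rewrite psumr_eq0; last by move=> j _; rewrite -expr2 sqr_ge0.
by move/allP => /(_ i); rewrite mem_index_enum => /(_ isT) /=; rewrite -expr2 sqrf_eq0 => /eqP.
Qed.

Lemma enorm_gt0 x : x != 0 -> 0 < enorm x.
Proof. by move=> x0; rewrite lt_neqAle eq_sym enorm_eq0 x0 enorm_ge0. Qed.

Lemma enorm0 : enorm (0 : V) = 0.
Proof. by apply/eqP; rewrite enorm_eq0. Qed.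

Lemma measurable_enorm : measurable_fun setT (@enorm R n).
Proof.
have ms : measurable_fun [set: R] (Num.sqrt : R -> R).
  by apply: continuous_measurable_fun; exact: sqrt_continuous.
exact: (measurableT_comp ms (@measurable_sqnorm R n)).
Qed.

Lemma measurable_unit_ball : measurable (@unit_ball R n).
Proof.
have := measurable_enorm measurableT (measurable_itv `]-oo, (1 : R)[).
by rewrite setTI; congr measurable; apply/seteqP; split => x /=; rewrite in_itv.
Qed.

Lemma measurable_power_at0 a : measurable_fun setT (@power_at0 R n a).
Proof.
rewrite (_ : power_at0 a = fun x : V => if enorm x == 0 then +oo%E else (enorm x `^ a)%:E).
  apply: measurable_fun_ifT => //.
    by apply: measurable_fun_eqr => //; exact: measurable_enorm.
  apply: measurableT_comp => //; apply: (measurableT_comp (measurable_powR a)).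
  exact: measurable_enorm.
by apply/funext => x; rewrite enorm_eq0.
Qed.

Lemma measurable_log_at0 : measurable_fun setT (@log_at0 R n).
Proof.
rewrite (_ : @log_at0 R n = fun x : V => if enorm x == 0 then +oo%E else (- ln (enorm x))%:E).
  apply: measurable_fun_ifT => //.
    by apply: measurable_fun_eqr => //; exact: measurable_enorm.
  apply: measurableT_comp => //; apply: measurableT_comp => //.
  by apply: (measurableT_comp (@measurable_ln R)); exact: measurable_enorm.
apply/funext => x; rewrite enorm_eq0 /log_at0; case: ifPn => // x0.
by rewrite div1r lnV ?posrE ?enorm_gt0.
Qed.

End enorm.

Section tempered.
Context {R : realType} {n : nat}.
Local Notation V := 'rV[R]_n.
Variable mu : {measure set V -> \bar R}.

(** The weight in exponential form, to be compared with others through the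
    exponents. *)
Lemma temperedP : tempered mu -> exists2 k : R, 0 <= k &
  (\int[mu]_x (expR (- (k / 2 * ln (1 + enorm x ^+ 2))))%:E < +oo)%E.
Proof.
move=> [k [k0 h]]; exists k => //; move: h; congr (_ < _)%E.
apply: eq_integral => x _; rewrite /powR ifF ?mulNr//.
by apply/negbTE; rewrite gt_eqF// ltr_wpDr ?sqr_ge0.
Qed.

Lemma measurable_weight (k : R) :
  measurable_fun setT (fun x : V => (expR (- (k / 2 * ln (1 + enorm x ^+ 2))))%:E).
Proof.
apply: measurableT_comp => //; apply: measurableT_comp => //.
apply: measurableT_comp => //; apply: measurable_funM => //.
apply: (measurableT_comp (@measurable_ln R)); apply: measurable_funD => //.
by apply: measurable_funX; exact: measurable_enorm.
Qed.

Lemma ge0_le_integral_lty (f g : V -> \bar R) (C : R) (D : set V) :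
  measurable D -> measurable_fun D f -> measurable_fun D g -> 0 <= C ->
  (forall x, D x -> 0 <= f x)%E -> (forall x, D x -> 0 <= g x)%E ->
  (forall x, D x -> f x <= C%:E * g x)%E ->
  (\int[mu]_(x in D) g x < +oo)%E -> (\int[mu]_(x in D) f x < +oo)%E.
Proof.
move=> mD mf mg C0 f0 g0 fg h.
apply: (@le_lt_trans _ _ (\int[mu]_(x in D) (C%:E * g x))%E).
  by apply: ge0_le_integral => //; apply: measurable_funeM.
by rewrite ge0_integralZl_EFin// lte_mul_pinfty.
Qed.

Lemma tempered_unit_ball_lty : tempered mu -> (mu (@unit_ball R n) < +oo)%E.
Proof.
move=> /temperedP[k k0 h]; have mB := @measurable_unit_ball R n.
rewrite -[X in (X < _)%E]mul1e -integral_cst//.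
apply: (@ge0_le_integral_lty _ (fun x => (expR (- (k / 2 * ln (1 + enorm x ^+ 2))))%:E) (expR (k / 2 * ln 2))) => //.
- by apply: measurable_funTS; exact: measurable_weight.
- move=> x Bx; rewrite /= -EFinM lee_fin -expRD -[leLHS]expR0 ler_expR subr_ge0.
  apply: ler_wpM2l; first by rewrite divr_ge0.
  rewrite ler_ln ?posrE//; last by rewrite ltr_wpDr ?sqr_ge0.
  rewrite -[X in _ <= X]/(1 + 1) lerD2l expr_le1//; first exact: ltW.
  exact: enorm_ge0.
apply: le_lt_trans h; apply: ge0_subset_integral => //; exact: measurable_weight.
Qed.

(** An exponential in [|x|] beats the weight of any order. *)
Lemma tempered_expR_lty (c : R) : 0 < c -> tempered mu ->
  (\int[mu]_x (expR (- (c * enorm x)))%:E < +oo)%E.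
Proof.
move=> c0 /temperedP[k k0 h].
have mexp : measurable_fun setT (fun x : V => (expR (- (c * enorm x)))%:E).
  apply: measurableT_comp => //; apply: measurableT_comp => //.
  apply: measurableT_comp => //; apply: measurable_funM => //.
  exact: measurable_enorm.
have [A A0 hA] := @ge_linear_expR R c (k + 1) c0 ltac:(lra).
apply: (@ge0_le_integral_lty _ (fun x => (expR (- (k / 2 * ln (1 + enorm x ^+ 2))))%:E)
  (expR (A + c))) => //; first exact: measurable_weight.
move=> x _; rewrite /= -EFinM lee_fin -expRD ler_expR.
have r0 := enorm_ge0 x; set rho := enorm x in r0 *.
have r1 : 0 < 1 + rho by lra.
have l1 : 0 <= ln (1 + rho) by rewrite ln_ge0// lerDl.
have l2 : ln (1 + rho ^+ 2) <= 2 * ln (1 + rho).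
  rewrite mulr_natl -lnXn// ler_ln ?posrE ?exprn_gt0 ?ltr_wpDr ?sqr_ge0//.
  by rewrite sqrrD expr1n -addrA lerD2l lerDr mul1r mulrn_wge0.
have := hA (ln (1 + rho)); rewrite lnK ?posrE//.
have : k / 2 * ln (1 + rho ^+ 2) <= k / 2 * (2 * ln (1 + rho)).
  by apply: ler_wpM2l => //; rewrite divr_ge0.
lra.
Qed.

End tempered.

(** * Integrability of functions comparable with a Bessel kernel *)

Section endgame.
Context {R : realType} {n : nat}.
Local Notation V := 'rV[R]_n.

Lemma bessel_enormE a m (x : V) : bessel a m x = macdonald ((a - n%:R) / 2) m (enorm x ^+ 2 / 4).
Proof. by rewrite /bessel enorm_sqr. Qed.

Lemma bessel0 a m : a <= n%:R -> 0 <= m -> bessel a m (0 : V) = +oo%E.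
Proof.
move=> an m0; rewrite bessel_enormE enorm0 expr0n mul0r macdonald_pinfty//.
by rewrite pmulr_lle0// subr_le0.
Qed.

(** Convolution of nonnegative functions is monotone in both arguments, so the
    bounds on [f] are convolved with themselves. *)
Lemma econv_bessel_bounds (a m1 m2 c1 c2 : R) (f : V -> \bar R) :
  0 < a -> 0 < c1 -> 0 < c2 -> measurable_fun setT f -> (forall x, 0 <= f x)%E ->
  (forall x, c1%:E * bessel a m1 x <= f x)%E ->
  (forall x, f x <= c2%:E * bessel a m2 x)%E ->
  exists C1 C2 : R, [/\ 0 < C1, 0 < C2,
    forall x, (C1%:E * bessel (2 * a) m1 x <= econv f f x)%E &
    forall x, (econv f f x <= C2%:E * bessel (2 * a) m2 x)%E].
Proof.
move=> a0 c10 c20 mf f0 h1 h2.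
have a20 : 0 < a / 2 by rewrite divr_gt0.
have bfin : beta_integral (a / 2) \is a fin_num.
  by rewrite ge0_fin_numE ?beta_integral_lty// ltW// beta_integral_gt0.
pose K := Num.sqrt (4 * pi : R) ^+ n * fine (beta_integral (a / 2)).
have K0 : 0 < K.
  apply: mulr_gt0; first by rewrite exprn_gt0// sqrtr_gt0 mulr_gt0// pi_gt0.
  by rewrite fine_gt0// beta_integral_gt0//= ltey_eq bfin.
have KE m (x : V) : econv (bessel a m) (bessel a m) x = (K%:E * bessel (2 * a) m x)%E.
  by rewrite bessel_conv /K EFinM fineK.
exists (c1 ^+ 2 * K), (c2 ^+ 2 * K); split.
- by rewrite mulr_gt0// exprn_gt0.
- by rewrite mulr_gt0// exprn_gt0.
- move=> x; rewrite EFinM -muleA -KE.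
  have := @econv_le R n (bessel a m1) f c1^-1 x (measurable_bessel _ _) mf
    (bessel_ge0 _ _) f0 (ltac:(by rewrite invr_ge0 ltW)).
  move=> /(_ _)/wrap[y|].
    by rewrite muleC lee_pdivlMr// muleC.
  rewrite exprVn => h; rewrite muleC -lee_pdivlMr ?exprn_gt0//.
  by rewrite muleC.
- move=> x; rewrite EFinM -muleA -KE.
  apply: econv_le => //; [exact: measurable_bessel|exact: bessel_ge0|exact: ltW].
Qed.

(** The residual integral left by [macdonald_decay] decreases in [|x|], so on
    the complement of the unit ball its value at [|x| = 1] bounds it. *)
Lemma bessel_decay (a k : R) (x : V) : 0 < k -> 1 <= enorm x ->
  (bessel a (k ^+ 2) x <= macdonald ((a - n%:R) / 2) (k ^+ 2 / 2) 8^-1 *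
     (expR (- (k / 2 * enorm x)))%:E)%E.
Proof.
move=> k0 x1; rewrite bessel_enormE muleC.
apply: (le_trans (macdonald_decay _ _ _)).
rewrite [k * _ / 2]mulrAC lee_pmul2l ?fin_num_fun//; last by rewrite lte_fin expR_gt0.
apply: macdonald_anti => //; rewrite -[leLHS]mul1r ler_pM2r ?invr_gt0//.
by rewrite exprn_ege1.
Qed.

Section equivalences.
Variable mu : {measure set V -> \bar R}.
Hypothesis tmu : tempered mu.
Variables (a m1 k2 C1 C2 : R) (h : V -> \bar R).
Hypotheses (a0 : 0 < a) (m10 : 0 < m1) (k20 : 0 < k2) (C10 : 0 < C1) (C20 : 0 < C2).
Hypotheses (mh : measurable_fun setT h) (h0 : forall x, (0 <= h x)%E).
Hypotheses (h1 : forall x, (C1%:E * bessel (2 * a) m1 x <= h x)%E).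
Hypotheses (h2 : forall x, (h x <= C2%:E * bessel (2 * a) (k2 ^+ 2) x)%E).

Let mB := @measurable_unit_ball R n.
Let k220 : 0 < k2 ^+ 2. Proof. exact: exprn_gt0. Qed.

(** Off the unit ball [h] decays exponentially. *)
Lemma unit_ball_integral_lty_total :
  (\int[mu]_(x in @unit_ball R n) h x < +oo)%E -> (\int[mu]_x h x < +oo)%E.
Proof.
move=> hB; rewrite -(setUv (@unit_ball R n)) ge0_integral_setU//=; last 3 first.
- exact: measurableC.
- by rewrite setUv.
- exact/disj_setPCl.
apply: lte_add_pinfty => //.
pose M := macdonald ((2 * a - n%:R) / 2) (k2 ^+ 2 / 2) (8^-1 : R).
have Mfin : M \is a fin_num.
  have k0 : 0 < k2 ^+ 2 / 2 by rewrite divr_gt0.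
  by apply: macdonald_fin_num; [exact: ltW|by rewrite invr_ge0|left|left].
apply: (@ge0_le_integral_lty _ _ _ _ (fun x => (expR (- (k2 / 2 * enorm x)))%:E) (C2 * fine M)).
- exact: measurableC.
- exact: measurable_funTS.
- apply: measurable_funTS; apply: measurableT_comp => //; apply: measurableT_comp => //.
  apply: measurableT_comp => //; apply: measurable_funM => //.
  exact: measurable_enorm.
- by rewrite mulr_ge0 ?fine_ge0 ?macdonald_ge0// ltW.
- by [].
- by move=> x _; rewrite lee_fin expR_ge0.
- move=> x /negP; rewrite -leNgt => x1; apply: (le_trans (h2 x)).
  rewrite EFinM fineK// -muleA lee_pmul2l//; exact: bessel_decay.
apply: le_lt_trans (@tempered_expR_lty _ _ mu (k2 / 2) _ tmu); last by rewrite divr_gt0.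
apply: ge0_subset_integral => //; first exact: measurableC.
apply: measurableT_comp => //; apply: measurableT_comp => //.
apply: measurableT_comp => //; apply: measurable_funM => //.
exact: measurable_enorm.
Qed.

(** For [|x| < 1] the exponential factors in the two-sided bounds on the kernel
    lie between positive constants, which leaves the power of [|x|]. At the
    origin both functions are infinite, so an atom there is treated alike. *)
Lemma subcritical_unit_ball_equiv : 2 * a < n%:R ->
  ((\int[mu]_(x in @unit_ball R n) power_at0 (2 * a - n%:R) x < +oo) <->
  (\int[mu]_(x in @unit_ball R n) h x < +oo))%E.
Proof.
move=> an; pose p := (2 * a - n%:R) / 2.
have p0 : p < 0 by rewrite pmulr_llt0// subr_lt0.
have pE (x : V) : x != 0 -> enorm x `^ (2 * a - n%:R) = expR (2 * p * ln (enorm x)).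
  move=> x0; rewrite /powR gt_eqF ?enorm_gt0//; congr (expR (_ * _)).
  by rewrite /p; field.
have mp := @measurable_power_at0 R n (2 * a - n%:R).
have p_ge0 (x : V) : (0 <= power_at0 (2 * a - n%:R) x)%E.
  by rewrite /power_at0; case: ifP => // _; rewrite lee_fin powR_ge0.
split; last first.
  pose c := expR (p - m1 * expR 1 - 2^-1).
  have c0 : 0 < c by exact: expR_gt0.
  apply: (@ge0_le_integral_lty _ _ _ _ _ ((C1 * c)^-1)) => //; try exact: measurable_funTS.
    by rewrite invr_ge0 mulr_ge0 ?ltW.
  move=> x Bx; rewrite muleC lee_pdivlMr ?mulr_gt0// muleC.
  apply: (le_trans _ (h1 x)); rewrite EFinM -muleA lee_pmul2l//.
  rewrite /power_at0; case: eqVneq => [->|x0].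
    by rewrite bessel0 ?leey//; exact: ltW.
  have r0 := enorm_gt0 x0.
  rewrite pE// bessel_enormE -/p -EFinM -expRD.
  apply: le_trans (macdonald_neg_ge (ltW p0) (ltW m10) r0).
  rewrite lee_fin ler_expR.
  have : m1 * expR 1 * enorm x <= m1 * expR 1.
    by rewrite ler_piMr ?mulr_ge0 ?expR_ge0 ?ltW.
  have := ltW Bx; lra.
pose M := macdonald p 0 (8^-1 : R).
have Mfin : M \is a fin_num.
  by apply: macdonald_fin_num; [|rewrite invr_ge0|right|left].
have M0 : (0 < M)%E by rewrite macdonald_gt0.
apply: (@ge0_le_integral_lty _ _ _ _ _ (C2 * fine M)) => //; try exact: measurable_funTS.
  by rewrite mulr_ge0 ?fine_ge0 ?macdonald_ge0// ltW.
move=> x Bx; apply: (le_trans (h2 x)); rewrite EFinM fineK// -muleA lee_pmul2l//.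
rewrite /power_at0; case: eqVneq => [->|x0].
  by rewrite gt0_muley// leey.
have r0 := enorm_gt0 x0.
rewrite pE// bessel_enormE -/p muleC.
apply: (le_trans (macdonald_neg_le _ _ r0)).
apply: lee_pmul; rewrite ?lee_fin ?expR_ge0 ?macdonald_ge0//.
rewrite ler_expR; have : 0 <= k2 * enorm x / 2 by rewrite divr_ge0 ?mulr_ge0 ?ltW.
lra.
Qed.

(** The upper bound on the kernel is logarithmic up to an additive constant,
    which is integrable on the unit ball because its measure is finite. *)
Lemma critical_unit_ball_equiv : 2 * a = n%:R ->
  ((\int[mu]_(x in @unit_ball R n) log_at0 x < +oo) <->
  (\int[mu]_(x in @unit_ball R n) h x < +oo))%E.
Proof.
move=> an.
have p0 : (2 * a - n%:R) / 2 = 0 by rewrite an subrr mul0r.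
have lE (x : V) : x != 0 -> ln (1 / enorm x) = - ln (enorm x).
  by move=> x0; rewrite div1r lnV ?posrE ?enorm_gt0.
have ml := @measurable_log_at0 R n.
have l_ge0 (x : V) : unit_ball x -> (0 <= log_at0 x)%E.
  move=> Bx; rewrite /log_at0; case: eqVneq => // x0.
  by rewrite lee_fin lE// oppr_ge0 ln_le0// ltW.
split; last first.
  pose c := expR (- m1 - 4^-1) * 2.
  have c0 : 0 < c by rewrite mulr_gt0 ?expR_gt0.
  apply: (@ge0_le_integral_lty _ _ _ _ _ ((C1 * c)^-1)) => //; try exact: measurable_funTS.
    by rewrite invr_ge0 mulr_ge0 ?ltW.
  have Cc0 : 0 < C1 * c by exact: mulr_gt0.
  move=> x Bx; rewrite [leRHS]muleC lee_pdivlMr// muleC.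
  apply: (le_trans _ (h1 x)); rewrite EFinM -muleA lee_pmul2l//.
  rewrite /log_at0; case: eqVneq => [->|x0].
    by rewrite bessel0 ?an ?leey//; exact: ltW.
  have r0 := enorm_gt0 x0.
  rewrite lE// bessel_enormE p0 -EFinM -mulrA; apply: macdonald0_ge; [exact: ltW|by rewrite r0 ltW].
move=> hl.
pose M := (macdonald 1 (k2 ^+ 2) 0 + macdonald (-1) 0 (4^-1 : R))%E.
have Mfin : M \is a fin_num.
  rewrite fin_numD; apply/andP; split; apply: macdonald_fin_num => //.
  - exact: ltW.
  - by left.
  - by right.
  - by right; rewrite ltrN10.
  - by left.
have M0 : (0 <= M)%E by rewrite adde_ge0 ?macdonald_ge0.
(* the additive [M] is the part of the critical integral off [|x|^2 <= t <= 1] *)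
apply: (@ge0_le_integral_lty _ _ _ _ (fun x => 2%:E * log_at0 x + M)%E C2) => //.
- exact: measurable_funTS.
- by apply: measurable_funTS; apply: emeasurable_funD => //; apply: measurable_funeM.
- exact: ltW.
- by move=> x Bx; rewrite adde_ge0// mule_ge0// l_ge0.
- move=> x Bx; apply: (le_trans (h2 x)); rewrite lee_pmul2l//.
  rewrite /log_at0; case: eqVneq => [->|x0].
    by rewrite gt0_muley// addye ?leey// -ltNye (lt_le_trans _ M0).
  have r0 := enorm_gt0 x0.
  rewrite lE// bessel_enormE p0 -EFinM; apply: macdonald0_le; [exact: ltW|by rewrite r0 ltW].
rewrite ge0_integralD//.
- rewrite ge0_integralZl_EFin//; last exact: measurable_funTS.
  apply: lte_add_pinfty; first by rewrite lte_mul_pinfty.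
  rewrite integral_cst// lte_mul_pinfty//; exact: tempered_unit_ball_lty.
- by move=> x Bx; rewrite mule_ge0// l_ge0.
- by apply: measurable_funeM; exact: measurable_funTS.
Qed.

(** The kernel is bounded by its value at the origin, now a convergent Gamma
    integral. *)
Lemma supercritical_unit_ball_lty : n%:R < 2 * a -> (\int[mu]_(x in @unit_ball R n) h x < +oo)%E.
Proof.
move=> an; pose p := (2 * a - n%:R) / 2.
have p0 : 0 < p by rewrite divr_gt0// subr_gt0.
pose M := macdonald p (k2 ^+ 2) (0 : R).
have Mfin : M \is a fin_num.
  by apply: macdonald_fin_num; [exact: ltW| |left|right].
apply: (@ge0_le_integral_lty _ _ _ _ (cst M) C2) => //.
- exact: measurable_funTS.
- exact: ltW.
- by move=> x _; exact: macdonald_ge0.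
- move=> x Bx; apply: (le_trans (h2 x)); rewrite lee_pmul2l// bessel_enormE.
  by apply: macdonald_anti => //; rewrite divr_ge0 ?sqr_ge0.
rewrite integral_cst// lte_mul_pinfty ?macdonald_ge0//; exact: tempered_unit_ball_lty.
Qed.

Lemma singularity_equiv :
  (singularity_condition a mu <-> (\int[mu]_(x in @unit_ball R n) h x < +oo)%E).
Proof.
rewrite /singularity_condition; have [an|an|an] := ltgtP (2 * a) n%:R.
- have aE : 0 < a < n%:R / 2 by rewrite a0 ltr_pdivlMr// mulrC.
  rewrite -subcritical_unit_ball_equiv//; split => [[/(_ aE)] //|h']; split => // a2.
  by move: an; rewrite a2 mulrC divfK// ltxx.
- split => [_|_]; first exact: supercritical_unit_ball_lty.
  split=> [/andP[_]|aE]; first by rewrite ltr_pdivlMr// mulrC ltNge (ltW an).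
  by move: an; rewrite aE mulrC divfK// ltxx.
- rewrite -critical_unit_ball_equiv//; split => [[_]|h']; first by apply; rewrite -an mulrAC divff ?mul1r.
  split => // /andP[_]; by rewrite ltr_pdivlMr// mulrC an ltxx.
Qed.

Lemma integrable_equiv (D : set V) : measurable D ->
  (mu.-integrable D h <-> (\int[mu]_(x in D) h x < +oo)%E).
Proof.
move=> mD; split => [/integrableP[_]|hD].
  by under eq_integral do rewrite gee0_abs//.
apply/integrableP; split; first exact: measurable_funTS.
by under eq_integral do rewrite gee0_abs//.
Qed.

Lemma bessel_comparable_equiv :
  (singularity_condition a mu <-> mu.-integrable setT h) /\
  (mu.-integrable setT h <-> mu.-integrable (@unit_ball R n) h).
Proof.
have e : mu.-integrable setT h <-> mu.-integrable (@unit_ball R n) h.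
  rewrite !integrable_equiv//; split; last exact: unit_ball_integral_lty_total.
  by apply: le_lt_trans; exact: ge0_subset_integral.
split => //; rewrite e integrable_equiv//; exact: singularity_equiv.
Qed.

End equivalences.
End endgame.

(** * Gaussians are Schwartz functions *)

Section schwartz_gauss.
Context {R : realType} {n : nat}.
Local Notation V := 'rV[R]_n.

(** A directional derivative is a derivative in one variable, for which the
    automatic differentiation of elementary functions is available. *)
Lemma is_derive_line (f : V -> R) (x v : V) (df : R) :
  is_derive (0 : R) 1 (fun h => f (h *: v + x)) df -> is_derive x v f df.
Proof.
have E : (fun h : R => h^-1 *: (((fun h => f (h *: v + x)) \o shift 0) (h *: (1 : R)) -
      f (0 *: v + x))) = (fun h => h^-1 *: ((f \o shift x) (h *: v) - f x)).
  by apply/funext => h /=; rewrite addr0 scale0r add0r /GRing.scale /= mulr1.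
move=> [d1 d2]; split; first by move: d1; rewrite /derivable E.
by move: d2; rewrite /derive E.
Qed.

(** The functions that are polynomial in the coordinates: a class closed under
    the partial derivatives of polynomials times a Gaussian, which is what an
    induction on the order of derivation requires. *)
Inductive polyfun : (V -> R) -> Prop :=
| polyfun_cst a : polyfun (fun=> a)
| polyfun_coord i : polyfun (fun x => x ord0 i)
| polyfunD p q : polyfun p -> polyfun q -> polyfun (fun x => p x + q x)
| polyfunM p q : polyfun p -> polyfun q -> polyfun (fun x => p x * q x).

Lemma polyfun_derive i p : polyfun p -> exists2 p', polyfun p' &
  forall x : V, is_derive x (delta_mx ord0 i : V) p (p' x).
Proof.
elim => {p} [a|j|p q _ [p' pp' dp] _ [q' pq' dq]|p q pp [p' pp' dp] pq [q' pq' dq]].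
- exists (fun=> 0); first exact: polyfun_cst.
  by move=> x; exact: is_derive_cst.
- exists (fun=> (delta_mx ord0 i : V) ord0 j); first exact: polyfun_cst.
  move=> x; apply: is_derive_line.
  rewrite (_ : (fun h => _) = (fun h : R => h * (delta_mx ord0 i : V) ord0 j + x ord0 j)); last first.
    by apply/funext => h; rewrite !mxE.
  by apply: trigger_derive; rewrite /GRing.scale /=; ring.
- exists (fun x => p' x + q' x); first exact: polyfunD.
  by move=> x; exact: is_deriveD.
- exists (fun x => p x * q' x + q x * p' x).
    by apply: polyfunD; apply: polyfunM.
  by move=> x; exact: is_deriveM.
Qed.

Lemma sqnorm_line (h : R) (v z : V) :
  sqnorm (h *: v + z) = h ^+ 2 * sqnorm v + 2 * h * dotp v z + sqnorm z.
Proof.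
rewrite /sqnorm /dotp !mulr_sumr -!big_split /=.
by apply: eq_bigr => i _; rewrite !mxE; ring.
Qed.

Lemma dotp_delta i (z : V) : dotp (delta_mx ord0 i) z = z ord0 i.
Proof.
rewrite /dotp (bigD1 i)//= mxE !eqxx mul1r big1 ?addr0// => j ji.
by rewrite mxE (negbTE ji) andbF mul0r.
Qed.

Lemma is_derive_gaussd c (y x : V) i :
  is_derive x (delta_mx ord0 i : V) (gaussd c y) (- 2 * c * (x ord0 i - y ord0 i) * gaussd c y x).
Proof.
apply: is_derive_line; rewrite /gaussd.
rewrite (_ : (fun h => _) = (fun h : R => expR (- c * (h ^+ 2 * sqnorm (delta_mx ord0 i : V) +
   2 * h * (x ord0 i - y ord0 i) + sqnorm (x - y))))); last first.
  by apply/funext => h; rewrite -addrA sqnorm_line dotp_delta !mxE.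
apply: trigger_derive; rewrite /GRing.scale /= expr0n/= !(mul0r, mulr0, add0r).
ring.
Qed.

Lemma is_derive_polygauss c (y : V) p i : polyfun p -> exists2 p', polyfun p' &
  forall x : V, is_derive x (delta_mx ord0 i : V) (fun x => p x * gaussd c y x) (p' x * gaussd c y x).
Proof.
move=> pp; have [p' pp' dp] := polyfun_derive i pp.
exists (fun x => p' x + p x * (- 2 * c * (x ord0 i + - y ord0 i))).
  by repeat constructor.
move=> x; have dg := is_derive_gaussd c y x i; have dpx := dp x.
apply: (@is_derive_eq _ _ _ _ _ _ _ _ (is_deriveM dpx dg)).
by rewrite /GRing.scale /=; ring.
Qed.

Lemma partials_polygauss c (y : V) s p : polyfun p -> exists2 p', polyfun p' &
  partials s (fun x => p x * gaussd c y x) = (fun x => p' x * gaussd c y x).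
Proof.
move=> pp; elim: s => [|i s [q pq sE]]; first by exists p.
have [q' pq' dq] := is_derive_polygauss c y i pq.
exists q' => //=; rewrite -/(partials s _) sE; apply/funext => x.
by rewrite /partial; apply: derive_val.
Qed.

Lemma norm_coord_le (x : V) i : `|x ord0 i| <= enorm x.
Proof.
rewrite -(@ler_pXn2r _ 2)// ?nnegrE ?enorm_ge0// enorm_sqr real_normK ?num_real//.
rewrite /sqnorm /dotp (bigD1 i)//= -expr2 lerDl sumr_ge0// => j _.
by rewrite -expr2 sqr_ge0.
Qed.

Lemma polyfun_bound p : polyfun p -> exists A N, forall x, `|p x| <= A * (1 + enorm x) ^+ N.
Proof.
elim => {p} [a|j|p q _ [A [N hp]] _ [B [M hq]]|p q pp [A [N hp]] pq [B [M hq]]].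
- by exists `|a|, 0 => x; rewrite expr0 mulr1.
- exists 1, 1 => x; rewrite mul1r expr1; apply: (le_trans (norm_coord_le x j)).
  by rewrite lerDr.
- have A0 : 0 <= A.
    by have := le_trans (normr_ge0 _) (hp 0); rewrite enorm0 addr0 expr1n mulr1.
  have B0 : 0 <= B.
    by have := le_trans (normr_ge0 _) (hq 0); rewrite enorm0 addr0 expr1n mulr1.
  exists (A + B), (N + M)%N => x; apply: (le_trans (ler_normD _ _)).
  have r1 : 1 <= 1 + enorm x by rewrite lerDl enorm_ge0.
  rewrite mulrDl lerD//.
    by apply: (le_trans (hp x)); rewrite ler_wpM2l// ler_weXn2l// leq_addr.
  by apply: (le_trans (hq x)); rewrite ler_wpM2l// ler_weXn2l// leq_addl.
- exists (A * B), (N + M)%N => x; rewrite normrM exprD mulrACA.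
  by apply: ler_pM.
Qed.

Lemma sqnorm_le_double (x y : V) : sqnorm x <= 2 * sqnorm (x - y) + 2 * sqnorm y.
Proof.
rewrite /sqnorm /dotp !mulr_sumr -big_split /=; apply: ler_sum => i _; rewrite !mxE.
have := sqr_ge0 (x ord0 i - 2 * y ord0 i); lra.
Qed.

(** A Gaussian is dominated by [(1 + |x|^2)^(-k/2)] for every [k]; the shift of
    the centre costs the constant [exp(c |y|^2)] through
    [sqnorm_le_double]. *)
Lemma gaussd_le_weight c (y : V) (k : R) : 0 < c -> exists2 C, 0 <= C &
  forall x, gaussd c y x <= C * expR (- (k / 2 * ln (1 + enorm x ^+ 2))).
Proof.
move=> c0.
have c20 : 0 < c / 2 by rewrite divr_gt0.
have [A A0 hA] := @ge_linear_expR R (c / 2) (`|k| / 2 + 1) c20 (ltac:(by rewrite ltr_wpDl// divr_ge0)).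
exists (expR (A + c / 2 + c * sqnorm y)); first exact: expR_ge0.
move=> x; rewrite -expRD ler_expR enorm_sqr.
have s0 := sqnorm_ge0 x.
have s1 : 0 < 1 + sqnorm x by rewrite ltr_wpDr.
have l0 : 0 <= ln (1 + sqnorm x) by rewrite ln_ge0// lerDl.
have := hA (ln (1 + sqnorm x)); rewrite lnK ?posrE// => h.
have kk : k / 2 * ln (1 + sqnorm x) <= `|k| / 2 * ln (1 + sqnorm x).
  by rewrite ler_wpM2r// ler_pM2r// ler_norm.
have := ler_wpM2l (ltW c20) (sqnorm_le_double x y).
lra.
Qed.

(** Every iterated partial derivative has again the form of a polynomial times
    the Gaussian, and polynomials grow at most as a power of [1 + |x|]. *)
Lemma schwartz_polygauss c (y : V) p : 0 < c -> polyfun p ->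
  schwartz_real (fun x => p x * gaussd c y x).
Proof.
move=> c0 pp; split.
  move=> s i x; have [q pq ->] := partials_polygauss c y s pp.
  have [q' _ dq] := is_derive_polygauss c y i pq.
  exact: ex_derive.
move=> s k; have [q pq ->] := partials_polygauss c y s pp.
have [A [N hq]] := polyfun_bound pq.
have [C C0 hC] := gaussd_le_weight y (2 * (k + N)%:R : R) c0.
have A0 : 0 <= A.
  by have := le_trans (normr_ge0 _) (hq 0); rewrite enorm0 addr0 expr1n mulr1.
exists (A * 2 ^+ (k + N) * C) => x.
have r0 := enorm_ge0 x; set rho := enorm x in r0 *.
have r1 : 0 <= 1 + rho by lra.
rewrite normrM (ger0_norm (expR_ge0 _)).
have h1 : (1 + rho) ^+ k * `|q x| <= A * (1 + rho) ^+ (k + N).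
  by rewrite exprD mulrCA ler_wpM2l ?exprn_ge0.
have h2 : (1 + rho) ^+ (k + N) <= 2 ^+ (k + N) * (1 + rho ^+ 2) ^+ (k + N).
  rewrite -exprMn; apply: lerXn2r; rewrite ?nnegrE//; first by rewrite mulr_ge0// addr_ge0 ?sqr_ge0.
  have := sqr_ge0 (rho - 1); have := sqr_ge0 rho; nra.
have h3 : (1 + rho ^+ 2) ^+ (k + N) * gaussd c y x <= C.
  have s1 : 0 < 1 + rho ^+ 2 by rewrite ltr_wpDr ?sqr_ge0.
  have := hC x; rewrite -/rho expRN ler_pdivlMr ?expR_gt0// => h.
  apply: le_trans h; rewrite mulrC ler_wpM2l ?expR_ge0//.
  rewrite -[X in X <= _]lnK ?posrE ?exprn_gt0// lnXn// ler_expR -[leLHS]mulr_natl.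
  have -> // : 2 * (k + N)%:R / 2 = (k + N)%:R :> R.
  by rewrite mulrAC divff ?mul1r// pnatr_eq0.
rewrite mulrA; apply: (@le_trans _ _ (A * (1 + rho) ^+ (k + N) * gaussd c y x)).
  by rewrite ler_wpM2r ?expR_ge0.
rewrite -!mulrA ler_wpM2l//.
apply: (@le_trans _ _ (2 ^+ (k + N) * (1 + rho ^+ 2) ^+ (k + N) * gaussd c y x)).
  by rewrite ler_wpM2r ?expR_ge0.
by rewrite -mulrA ler_wpM2l// exprn_ge0.
Qed.

Lemma schwartz_gaussd c (y : V) : 0 < c ->
  schwartz (fun x => (gaussd c y x)%:C%C).
Proof.
move=> c0; split => /=.
  have := schwartz_polygauss y c0 (polyfun_cst 1).
  by under eq_fun do rewrite mul1r.
have := schwartz_polygauss y c0 (polyfun_cst 0).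
by under eq_fun do rewrite mul0r.
Qed.

End schwartz_gauss.

(** * Gaussian approximation of the identity *)

Section approx.
Context {R : realType} {n : nat}.
Local Notation V := 'rV[R]_n.

(** The constant that normalizes [gaussd c y] to have integral [1]. *)
Definition gauss_peak (c : R) : R := Num.sqrt (c / pi) ^+ n.

Lemma gauss_peak_gt0 c : 0 < c -> 0 < gauss_peak c.
Proof. by move=> c0; rewrite exprn_gt0// sqrtr_gt0 divr_gt0// pi_gt0. Qed.

Lemma gauss_peakV c : 0 < c -> gauss_peak c * Num.sqrt (pi / c) ^+ n = 1.
Proof.
move=> c0; rewrite /gauss_peak -exprMn -sqrtrM ?divr_ge0 ?pi_ge0 ?ltW//.
by rewrite mulrA divfK ?gt_eqF ?pi_gt0// divff ?gt_eqF// sqrtr1 expr1n.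
Qed.

Lemma integrable_gaussd c (y : V) : 0 < c ->
  (lebd n).-integrable setT (fun x => (gaussd c y x)%:E).
Proof.
move=> c0; apply/integrableP; split.
  by apply: measurableT_comp => //; exact: measurable_gaussd.
under eq_integral do rewrite gee0_abs ?lee_fin ?expR_ge0//.
by rewrite integral_gaussd// ltry.
Qed.

Lemma Rintegral_gaussd c (y : V) : 0 < c ->
  Rintegral (lebd n) setT (gaussd c y) = Num.sqrt (pi / c) ^+ n.
Proof. by move=> c0; rewrite /Rintegral integral_gaussd. Qed.

(** The normalizing constant grows as a power of the rate, whereas the Gaussian
    decays exponentially in the rate at a fixed distance from its centre. The
    rate [1/2] is left aside to keep an integrable weight. *)
Lemma gauss_peak_decay (rho : R) : 0 < rho -> exists2 C, 0 <= C &
  forall m : nat, gauss_peak m.+1%:R * expR (- (m.+1%:R - 2^-1) * rho) <= C / m.+1%:R.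
Proof.
move=> rho0.
have [A A0 hA] := @ge_linear_expR R rho n.+1%:R rho0 (ltr0Sn _ _).
exists (expR (A + rho / 2)); first exact: expR_ge0.
move=> m; set c : R := m.+1%:R.
have c0 : 0 < c by rewrite ltr0Sn.
have c1 : 1 <= c by rewrite ler1n.
rewrite ler_pdivlMr// mulrAC.
have pk : gauss_peak c <= c ^+ n.
  have c0' := ltW c0.
  apply: lerXn2r; rewrite ?nnegrE ?sqrtr_ge0//.
  apply: (@le_trans _ _ (Num.sqrt (c ^+ 2))); last by rewrite sqrtr_sqr ger0_norm.
  rewrite ler_wsqrtr// ler_pdivrMr ?pi_gt0// expr2 -mulrA ler_peMr//.
  have pi1 : 1 <= pi :> R by apply: le_trans (@pi_ge2 R); rewrite ler1n.
  by rewrite -[leLHS]mul1r ler_pM.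
apply: (@le_trans _ _ (c ^+ n * c * expR (- (c - 2^-1) * rho))).
  by rewrite ler_wpM2r ?expR_ge0// ler_pM2r.
rewrite -exprSr -[X in X ^+ _]lnK ?posrE// -expRM_natl -expRD ler_expR.
have := hA (ln c); rewrite lnK ?posrE//; lra.
Qed.

(** Near [y] the function [g] is at least [M], so the average of [g - M] against
    the normalized Gaussian of rate [m + 1] can be negative only through the
    region away from [y]; there the Gaussian is at most [C / (m + 1)] times the
    fixed Gaussian of rate [1/2], against which [g - M] is integrable. A
    one-sided statement, since it is to be applied to a kernel whose value at
    [y] may a priori be infinite. *)
Lemma gauss_limit_ge (g : V -> R) (y : V) (M A rho : R) : 0 < rho ->
  measurable_fun setT g ->
  (forall c, 0 < c -> (lebd n).-integrable setT (fun x => (g x * gaussd c y x)%:E)) ->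
  (forall x, sqnorm (x - y) < rho -> M <= g x) ->
  (fun m : nat => gauss_peak m.+1%:R *
     Rintegral (lebd n) setT (fun x => g x * gaussd m.+1%:R y x)) @ \oo --> A ->
  M <= A.
Proof.
move=> rho0 mg ig gM gA.
have [C C0 hC] := gauss_peak_decay rho0.
have c20 : (0 : R) < 2^-1 by rewrite invr_gt0.
have iM c : 0 < c -> (lebd n).-integrable setT (EFin \o (fun x => (g x - M) * gaussd c y x)).
  move=> c0; have := integrableB measurableT (ig c c0)
    (integrableZl measurableT M (integrable_gaussd y c0)).
  by apply: eq_integrable => // x _; rewrite /= mulrBl EFinB.
pose I := Rintegral (lebd n) setT (fun x => `|g x - M| * gaussd 2^-1 y x).
have iI : (lebd n).-integrable setT (EFin \o (fun x => `|g x - M| * gaussd 2^-1 y x)).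
  have := integrable_abse (iM _ c20).
  apply: eq_integrable => // x _ /=.
  by rewrite normrM (ger0_norm (expR_ge0 _)).
have main m : M <= gauss_peak m.+1%:R *
     Rintegral (lebd n) setT (fun x => g x * gaussd m.+1%:R y x) + C * I * m.+1%:R^-1.
  set c : R := m.+1%:R; have c0 : 0 < c by rewrite ltr0Sn.
  have pc := gauss_peak_gt0 c0.
  have -> : gauss_peak c * Rintegral (lebd n) setT (fun x => g x * gaussd c y x) =
      M + Rintegral (lebd n) setT (fun x => gauss_peak c * ((g x - M) * gaussd c y x)).
    rewrite RintegralZl//; last exact: iM.
    have -> : Rintegral (lebd n) setT (fun x => (g x - M) * gaussd c y x) =
        Rintegral (lebd n) setT (fun x => g x * gaussd c y x) -
        M * Rintegral (lebd n) setT (gaussd c y).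
      rewrite -RintegralZl//; last exact: integrable_gaussd.
      rewrite -RintegralB//; [|exact: ig|exact: (integrableZl measurableT M (integrable_gaussd y c0))].
      by apply: eq_Rintegral => x _; rewrite mulrBl.
    by rewrite Rintegral_gaussd// mulrBr mulrCA gauss_peakV// mulr1 addrC subrK.
  rewrite -addrA lerDl.
  have -> : C * I / c = - Rintegral (lebd n) setT (fun x => - (C / c) * (`|g x - M| * gaussd 2^-1 y x)).
    by rewrite RintegralZl// -/I; ring.
  rewrite subr_ge0; apply: le_Rintegral => //.
  - exact: (integrableZl measurableT _ iI).
  - exact: (integrableZl measurableT _ (iM _ c0)).
  move=> x _.
  have [xr|xr] := ltP (sqnorm (x - y)) rho.
    apply: (@le_trans _ _ 0).
      by rewrite mulNr oppr_le0 !mulr_ge0 ?invr_ge0 ?expR_ge0// ltW.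
    by rewrite !mulr_ge0 ?expR_ge0 ?subr_ge0 ?gM// ltW.
  have h1 : gauss_peak c * gaussd c y x <= C / c * gaussd 2^-1 y x.
    have -> : gaussd c y x = expR (- (c - 2^-1) * sqnorm (x - y)) * gaussd 2^-1 y x.
      by rewrite /gaussd -expRD; congr expR; ring.
    rewrite mulrA ler_wpM2r ?expR_ge0//; apply: le_trans (hC m).
    rewrite -/c ler_pM2l// ler_expR !mulNr lerN2 ler_wpM2l//.
    rewrite subr_ge0; apply: (@le_trans _ _ 1); last by rewrite ler1n.
    by rewrite invf_le1// ler1n.
  rewrite mulNr [X in - X](_ : _ = `|g x - M| * (C / c * gaussd 2^-1 y x)); last by ring.
  apply: (@le_trans _ _ (- (`|g x - M| * (gauss_peak c * gaussd c y x)))).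
    by rewrite lerN2 ler_wpM2l.
  rewrite [leRHS]mulrCA -mulNr ler_wpM2r//; first by rewrite mulr_ge0 ?expR_ge0 ?ltW.
  by have := ler_norm (- (g x - M)); rewrite normrN => h; rewrite lerNl.
have cvgM : (fun m : nat => gauss_peak m.+1%:R *
     Rintegral (lebd n) setT (fun x => g x * gaussd m.+1%:R y x) + C * I * m.+1%:R^-1) @ \oo --> A + C * I * 0.
  apply: cvgD => //; apply: cvgM; first exact: cvg_cst.
  exact: cvg_harmonic.
rewrite mulr0 addr0 in cvgM.
by apply: (cvgr_to_ge cvgM); near=> m; exact: main.
Unshelve. all: by end_near. Qed.

End approx.

(** * Identification of the Bessel kernel *)

Section pairing.
Context {R : realType} {n : nat}.
Local Notation V := 'rV[R]_n.
Local Notation leb := (@lebesgue_measure R).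

Lemma Re_scalel (a : R) (z : R[i]) : complex.Re (a%:C%C * z) = a * complex.Re z.
Proof. by case: z => u v /=; rewrite mul0r subr0. Qed.

Lemma Re_scaler (a : R) (z : R[i]) : complex.Re (z * a%:C%C) = complex.Re z * a.
Proof. by case: z => u v /=; rewrite mulr0 subr0. Qed.

(** The Gamma integral, rescaled by [1 + |xi|^2]. *)
Lemma bessel_symbolE (b : R) (xi : V) : 0 < b ->
  macdonald (b / 2) (1 + sqnorm xi) 0 =
  (fine (macdonald (b / 2) 1 0) * bessel_symbol b xi)%:E.
Proof.
move=> b0.
have b20 : 0 < b / 2 by rewrite divr_gt0.
have s1 : 0 < 1 + sqnorm xi by rewrite ltr_wpDr// sqnorm_ge0.
have gf : macdonald (b / 2) 1 (0 : R) \is a fin_num.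
  by apply: macdonald_fin_num => //; [left|right].
rewrite (macdonald_shift _ _ _ (- ln (1 + sqnorm xi))) mul0r expRN lnK ?posrE//.
rewrite divff ?gt_eqF// EFinM fineK// muleC; congr (_ * _%:E)%E.
by rewrite /bessel_symbol enorm_sqr /powR gt_eqF// mulrN mulNr.
Qed.

(** Writing the symbol as a mixture of the Gaussians [exp(-t |xi|^2)] and
    exchanging integrals reduces its Fourier integral, regularized by
    [exp(-eps |xi|^2)], to the transform of a Gaussian of rate [t + eps]. The
    result is the heat mixture with all times shifted by [eps]. *)
Lemma bessel_fourier (b eps : R) (y : V) : 0 < b -> 0 < eps ->
  let F := fun xi : V => bessel_symbol b xi * (cos (dotp xi y) * gaussd eps 0 xi) in
  (lebd n).-integrable setT (EFin \o F) /\
  Rintegral (lebd n) setT F =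
    (fine (macdonald (b / 2) 1 0))^-1 * Num.sqrt pi ^+ n *
    Rintegral leb setT (fun u => expR (b / 2 * u - expR u) * heat (ln (expR u + eps)) y).
Proof.
move=> b0 eps0 F.
have b20 : 0 < b / 2 by rewrite divr_gt0.
set gam := fine _.
have gf : macdonald (b / 2) 1 (0 : R) \is a fin_num.
  by apply: macdonald_fin_num => //; [left|right].
have g0 : 0 < gam.
  by rewrite fine_gt0// macdonald_gt0//= ltey_eq gf.
pose G (p : R * V) : R := expR (b / 2 * p.1 - expR p.1) *
  (cos (dotp p.2 y) * gaussd (expR p.1 + eps) 0 p.2).
have mG : measurable_fun setT (EFin \o G).
  apply: measurableT_comp => //; apply: measurable_funM.
    apply: measurableT_comp => //; apply: measurable_funB; first exact: measurable_funM.
    exact: measurableT_comp.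
  apply: measurable_funM.
    apply: (measurableT_comp (continuous_measurable_fun (@continuous_cos R))).
    by apply: measurable_dotp.
  apply: measurableT_comp => //; apply: measurable_funM.
    apply: measurableT_comp => //; apply: measurable_funD => //.
    exact: measurableT_comp.
  by apply: measurable_dotp; apply: measurable_rVB.
have eu u : 0 < expR u + eps :> R by rewrite addr_gt0 ?expR_gt0.
have inner u : Rintegral (lebd n) setT (fun xi => G (u, xi)) =
   Num.sqrt pi ^+ n * (expR (b / 2 * u - expR u) * heat (ln (expR u + eps)) y) /\
   (lebd n).-integrable setT (fun xi => (G (u, xi))%:E).
  have [ic _ cE _] := @gauss_fourier R n _ 0 y (eu u).
  split; last first.
    exact: (integrableZl measurableT (expR (b / 2 * u - expR u)) ic).
  have -> : Rintegral (lebd n) setT (fun xi => G (u, xi)) = expR (b / 2 * u - expR u) *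
      Rintegral (lebd n) setT (fun xi => cos (dotp xi y) * gaussd (expR u + eps) 0 xi).
    exact: (RintegralZl (expR (b / 2 * u - expR u)) measurableT ic).
  rewrite cE.
  have -> : dotp 0 y = 0 by apply: big1 => i _; rewrite mxE mul0r.
  rewrite cos0 mulr1 [RHS]mulrCA; congr (_ * _).
  have cu := eu u; set c := expR u + eps in cu *.
  have sE : Num.sqrt (pi / c) = Num.sqrt pi * expR (- ln c / 2).
    rewrite sqrtrM ?pi_ge0//; congr (_ * _).
    have -> : c^-1 = expR (- ln c / 2) ^+ 2.
      by rewrite -expRM_natr divfK// expRN lnK.
    by rewrite sqrtr_sqr ger0_norm// expR_ge0.
  rewrite sE exprMn -mulrA; congr (_ * _).
  rewrite -expRM_natr -expRD /heat expRN lnK ?posrE//; congr expR.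
  by field; rewrite gt_eqF.
have hE (xi : V) u : G (u, xi) = (cos (dotp xi y) * gaussd eps 0 xi) *
    expR (macdonald_exponent (b / 2) (1 + sqnorm xi) 0 u).
  rewrite /G /macdonald_exponent /gaussd /= subr0 [LHS]mulrCA -[RHS]mulrA; congr (_ * _).
  by rewrite -!expRD; congr expR; ring.
have iG : (leb \x lebd n)%E.-integrable setT (EFin \o G).
  apply/integrable12ltyP => //.
  pose k := Num.sqrt (pi / eps) ^+ n.
  have k0 : 0 <= k by rewrite exprn_ge0.
  have inle u : (\int[lebd n]_xi `|(G (u, xi))%:E| <=
      k%:E * (expR (macdonald_exponent (b / 2) 1 0 u))%:E)%E.
    rewrite muleC -(integral_gaussd (0 : V) eps0) -ge0_integralZl_EFin ?expR_ge0//; last first.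
    + by apply: measurableT_comp => //; exact: measurable_gaussd.
    + by move=> x _; rewrite lee_fin expR_ge0.
    apply: ge0_le_integral => //.
    + apply: measurableT_comp => //.
      exact: (measurableT_comp mG (pair1_measurable u)).
    + apply: measurable_funeM; apply: measurableT_comp => //; exact: measurable_gaussd.
    move=> x _; rewrite abse_EFin -EFinM lee_fin /G !normrM !(ger0_norm (expR_ge0 _)).
    have -> : macdonald_exponent (b / 2) 1 0 u = b / 2 * u - expR u.
      by rewrite /macdonald_exponent; ring.
    rewrite /= ler_wpM2l ?expR_ge0//.
    apply: (@le_trans _ _ (gaussd (expR u + eps) 0 x)).
      by rewrite ler_piMl ?expR_ge0 ?cos_max.
    rewrite ler_expR !mulNr lerN2 ler_wpM2r ?sqnorm_ge0// lerDr expR_ge0//.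
  apply: (@le_lt_trans _ _ (\int[leb]_u (k%:E * (expR (macdonald_exponent (b / 2) 1 0 u))%:E))%E).
    apply: ge0_le_integral => //.
    + by move=> u _; apply: integral_ge0.
    + apply: (measurable_lebd_integral (f := fun p : R * V => `|(G p)%:E|%E)) => //.
      exact: measurableT_comp.
    + by apply: measurable_funeM; exact: measurable_macdonald.
    + by move=> u _; exact: inle.
  rewrite ge0_integralZl_EFin//; last exact: measurable_macdonald.
  by apply: lte_mul_pinfty => //; rewrite ltey_eq gf.
have outer xi : (\int[leb]_u (G (u, xi))%:E)%E = (gam * F xi)%:E.
  have s1 : 0 < 1 + sqnorm xi by rewrite ltr_wpDr// sqnorm_ge0.
  have mfin : macdonald (b / 2) (1 + sqnorm xi) (0 : R) \is a fin_num.
    by apply: macdonald_fin_num => //; [exact: ltW|left|right].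
  under eq_integral do rewrite hE EFinM.
  rewrite integralZl//.
    rewrite -/(macdonald _ _ _) bessel_symbolE// -EFinM; congr EFin.
    by rewrite /F -/gam; ring.
  apply/integrableP; split; first exact: measurable_macdonald.
  under eq_integral do rewrite gee0_abs ?lee_fin ?expR_ge0//.
  by rewrite -/(macdonald _ _ _) ltey_eq mfin.
have iF : (lebd n).-integrable setT (EFin \o F).
  apply: (le_integrable measurableT _ _ (integrable_gaussd (0 : V) eps0)).
    apply: measurableT_comp => //; apply: measurable_funM.
      apply: (measurableT_comp (measurable_powR _)); apply: measurable_funD => //.
      by apply: measurable_funX; exact: measurable_enorm.
    apply: measurable_funM; last exact: measurable_gaussd.
    apply: (measurableT_comp (continuous_measurable_fun (@continuous_cos R))).
    exact: measurable_dotp.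
  move=> xi _; rewrite /= lee_fin /F !normrM.
  apply: (@le_trans _ _ (1 * (1 * `|gaussd eps 0 xi|))); last by rewrite !mul1r.
  apply: ler_pM => //; last first.
    by apply: ler_wpM2r => //; exact: cos_max.
  rewrite /bessel_symbol ger0_norm ?powR_ge0// /powR gt_eqF ?ltr_wpDr ?sqr_ge0//.
  rewrite -[leRHS]expR0 ler_expR mulNr oppr_le0 mulr_ge0 ?(ltW b20)// ln_ge0//.
  by rewrite lerDl sqr_ge0.
split => //.
pose H u := expR (b / 2 * u - expR u) * heat (ln (expR u + eps)) y.
pose k := Num.sqrt (pi : R) ^+ n.
have k0 : 0 < k by rewrite exprn_gt0// sqrtr_gt0 pi_gt0.
have innerE u : (\int[lebd n]_xi (G (u, xi))%:E)%E = (k * H u)%:E.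
  have [e i] := inner u.
  by rewrite /k /H -e /Rintegral fineK// integrable_fin_num.
have iH : leb.-integrable setT (EFin \o H).
  have := integrableZl measurableT k^-1 (integrable_fubini_F iG).
  apply: eq_integrable => // u _.
  by rewrite /fubini_F innerE -EFinM mulKf ?gt_eqF.
have : gam * Rintegral (lebd n) setT F = k * Rintegral leb setT H.
  rewrite -!RintegralZl// /Rintegral; congr fine.
  transitivity (\int[lebd n]_xi \int[leb]_u (G (u, xi))%:E)%E.
    by apply: eq_integral => xi _; rewrite outer.
  transitivity (\int[leb]_u \int[lebd n]_xi (G (u, xi))%:E)%E.
    exact/esym/(Fubini iG).
  by apply: eq_integral => u _; rewrite innerE.
move=> e; rewrite -/H -/k -mulrA -e mulKf ?gt_eqF//.
Qed.

End pairing.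

Section kernel.
Context {R : realType} {n : nat}.
Local Notation V := 'rV[R]_n.
Local Notation leb := (@lebesgue_measure R).

(** The factor [(2 pi)^(-n/2)] of the Fourier inversion, times [pi^(n/2)] from
    the transform of a Gaussian, divided by [Gamma(b/2)]. *)
Definition bessel_const (b : R) : R :=
  ((2 * pi) `^ (n%:R / 2))^-1 * ((fine (macdonald (b / 2) 1 0))^-1 * Num.sqrt pi ^+ n).

Lemma bessel_const_gt0 b : 0 < b -> 0 < bessel_const b.
Proof.
move=> b0; have b20 : 0 < b / 2 by rewrite divr_gt0.
apply: mulr_gt0; first by rewrite invr_gt0 powR_gt0// mulr_gt0// pi_gt0.
apply: mulr_gt0; last by rewrite exprn_gt0// sqrtr_gt0 pi_gt0.
have gf : macdonald (b / 2) 1 (0 : R) \is a fin_num.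
  by apply: macdonald_fin_num => //; [left|right].
by rewrite invr_gt0 fine_gt0// macdonald_gt0//= ltey_eq gf.
Qed.

Lemma dotpC (x y : V) : dotp x y = dotp y x.
Proof. by apply: eq_bigr => i _; rewrite mulrC. Qed.

(** The real part of the defining identity of the kernel, tested on the
    Gaussian of rate [c] centred at [y]: its inverse Fourier transform is a
    multiple of [cos(y . xi)] times the Gaussian of rate [1/(4c)], which
    regularizes the symbol as [bessel_fourier] requires. *)
Lemma bessel_kernel_pairing (b c : R) (y : V) (K : V -> \bar R) : 0 < b -> 0 < c ->
  is_bessel_kernel b K ->
  @gauss_peak R n c * Rintegral (lebd n) setT (fun x => fine (K x) * gaussd c y x) =
  bessel_const b * Rintegral leb setT (fun u =>
     expR (b / 2 * u - expR u) * heat (ln (expR u + (4 * c)^-1)) y).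
Proof.
move=> b0 c0 [_ _ /(_ _ (schwartz_gaussd y c0)) /(congr1 (@complex.Re R))].
rewrite /cintegral.
set L := Rintegral _ _ _; set L' := Rintegral _ _ _; set M := Rintegral _ _ _; set M' := Rintegral _ _ _.
rewrite [LHS]/= [RHS]/=.
have eps0 : 0 < (4 * c)^-1 by rewrite invr_gt0 mulr_gt0.
have [iF FE] := bessel_fourier y b0 eps0.
pose k := Num.sqrt (pi / c) ^+ n.
pose N := ((2 * pi : R) `^ (n%:R / 2))^-1.
have -> : L = Rintegral (lebd n) setT (fun x => fine (K x) * gaussd c y x).
  by apply: eq_Rintegral => x _; rewrite Re_scalel.
have -> : M = N * k * Rintegral (lebd n) setT (fun xi =>
    bessel_symbol b xi * (cos (dotp xi y) * gaussd (4 * c)^-1 0 xi)).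
  rewrite -RintegralZl//; apply: eq_Rintegral => xi _.
  rewrite Re_scalel /inv_fourier Re_scalel -/N /cintegral [complex.Re _]/=.
  have [_ _ cE _] := @gauss_fourier R n c y xi c0.
  have -> : Rintegral (lebesgue_rV R n) setT (fun x =>
      complex.Re (expi (dotp x xi) * (gaussd c y x)%:C%C)) =
      k * expR (- (sqnorm xi / (4 * c))) * cos (dotp y xi).
    by rewrite -cE; apply: eq_Rintegral => x _; rewrite Re_scaler.
  have -> : gaussd (4 * c)^-1 0 xi = expR (- (sqnorm xi / (4 * c))).
    by rewrite /gaussd subr0 mulNr mulrC.
  by rewrite (dotpC xi y); ring.
move=> ->; rewrite FE /bessel_const -/N.
transitivity (N * (@gauss_peak R n c * k) * ((fine (macdonald (b / 2) 1 0))^-1 * Num.sqrt pi ^+ n *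
   Rintegral leb setT (fun u => expR (b / 2 * u - expR u) * heat (ln (expR u + (4 * c)^-1)) y))).
  by ring.
by rewrite gauss_peakV//; ring.
Qed.

Lemma continuous_ereal_measurable (K : V -> \bar R) : continuous K -> measurable_fun setT K.
Proof.
move=> /continuousP cK; apply: (measurability _ (ErealGenOInfty.measurableE R)) => //.
move=> _ [_ [r ->] <-]; rewrite setTI; apply: sub_sigma_algebra.
by apply: cK; rewrite set_itvE; exact: open_ereal_gt_ereal.
Qed.

(** A Gaussian is below every tempered weight. *)
Lemma bessel_kernel_integrable (b c : R) (y : V) (K : V -> \bar R) : 0 < c ->
  is_bessel_kernel b K ->
  (lebd n).-integrable setT (fun x => K x * (gaussd c y x)%:E)%E.
Proof.
move=> c0 [cK [k [k0 hk]] _].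
have mK := continuous_ereal_measurable cK.
have mg : measurable_fun setT (fun x : V => (gaussd c y x)%:E).
  by apply: measurableT_comp => //; exact: measurable_gaussd.
have [C C0 hC] := gaussd_le_weight y k c0.
apply/integrableP; split; first exact: emeasurable_funM.
have mw : measurable_fun setT (fun x : V => `|K x| * ((1 + enorm x ^+ 2) `^ (- (k / 2)))%:E)%E.
  apply: emeasurable_funM; first exact: measurableT_comp.
  apply: measurableT_comp => //; apply: (measurableT_comp (measurable_powR _)).
  by apply: measurable_funD => //; apply: measurable_funX; exact: measurable_enorm.
apply: (@ge0_le_integral_lty R n (lebesgue_rV R n) _ _ C setT _ _ mw) => //.
- by apply: measurableT_comp => //; exact: emeasurable_funM.
- by move=> x _; rewrite mule_ge0// lee_fin powR_ge0.
move=> x _; rewrite abseM muleCA lee_wpmul2l// abse_EFin -EFinM lee_fin.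
rewrite ger0_norm ?expR_ge0//; apply: (le_trans (hC x)).
by rewrite /powR gt_eqF ?mulNr// ltr_wpDr ?sqr_ge0.
Qed.

(** For [y != 0] the function [heat v y] is bounded in [v], because
    [exp(-|y|^2/(4t))] compensates the power of the small time [t]. The
    integrands are thus dominated by the Gamma density. *)
Lemma heat_shift_cvg (b : R) (y : V) : (0 < n)%N -> 0 < b -> y != 0 ->
  (fun m : nat => Rintegral leb setT (fun u =>
     expR (b / 2 * u - expR u) * heat (ln (expR u + (4 * m.+1%:R)^-1)) y)) @ \oo -->
  fine (bessel b 1 y).
Proof.
move=> n0 b0 y0.
have b20 : 0 < b / 2 by rewrite divr_gt0.
have q0 : 0 < sqnorm y / 4 by rewrite divr_gt0// -enorm_sqr exprn_gt0// enorm_gt0.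
have n20 : 0 < n%:R / 2 :> R by rewrite divr_gt0// ltr0n.
have [A A0 hA] := ge_linear_expR q0 n20.
pose f_ (m : nat) (u : R) : \bar R :=
  (expR (b / 2 * u - expR u) * heat (ln (expR u + (4 * m.+1%:R)^-1)) y)%:E.
have eps0 (m : nat) : 0 < (4 * m.+1%:R)^-1 :> R by rewrite invr_gt0 mulr_gt0// ltr0Sn.
have mexp : measurable_fun [set: R] (fun u : R => expR (b / 2 * u - expR u)).
  apply: measurableT_comp => //; apply: measurable_funB; first exact: measurable_funM.
  exact: measurable_expR.
have mheat : measurable_fun [set: R] (fun v : R => heat v y).
  exact: (measurableT_comp (@measurable_heat R n) (pair2_measurable y)).
have mf m : measurable_fun [set: R] (f_ m).
  apply: measurableT_comp => //; apply: measurable_funM => //.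
  apply: (measurableT_comp mheat); apply: (measurableT_comp (@measurable_ln R)).
  by apply: measurable_funD => //; exact: measurable_expR.
have mfoo : measurable_fun [set: R] (fun u => (bessel_density b 1 u y)%:E).
  exact: (measurableT_comp (@measurable_bessel_density R n b 1) (pair2_measurable y)).
have cont_heat (v : R) : {for v, continuous (fun v : R => heat v y)}.
  by apply: differentiable_continuous; apply/derivable1_diffP; apply: ex_derive.
have f_cvg u : f_ m u @[m --> \oo] --> (bessel_density b 1 u y)%:E.
  rewrite /bessel_density mul1r; apply: cvg_EFin; first by near=> m.
  apply: cvgM; first exact: cvg_cst.
  rewrite -[X in _ --> heat X y](expRK u).
  apply: (cvg_comp (fun m : nat => ln (expR u + (4 * m.+1%:R)^-1)) (fun v => heat v y)); last exact: cont_heat.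
  apply: (cvg_comp (fun m : nat => expR u + (4 * m.+1%:R)^-1) (@ln R)); last first.
    by apply: continuous_ln; exact: expR_gt0.
  have h0 : (fun m : nat => expR u + 4^-1 * m.+1%:R^-1) @ \oo --> expR u + 4^-1 * 0.
    apply: cvgD; first exact: cvg_cst.
    by apply: cvgM; [exact: cvg_cst|exact: cvg_harmonic].
  rewrite mulr0 addr0 in h0.
  by under eq_fun do rewrite invfM.
pose g u : \bar R := (expR A * expR (macdonald_exponent (b / 2) 1 0 u))%:E.
have gf : macdonald (b / 2) 1 (0 : R) \is a fin_num.
  by apply: macdonald_fin_num => //; [left|right].
have ig : leb.-integrable setT g.
  have im : leb.-integrable setT (fun u => (expR (macdonald_exponent (b / 2) 1 0 u))%:E).
    apply/integrableP; split; first exact: measurable_macdonald.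
    under eq_integral do rewrite gee0_abs ?lee_fin ?expR_ge0//.
    by rewrite -/(macdonald _ _ _) ltey_eq gf.
  exact: (integrableZl measurableT (expR A) im).
have fle m u : (`|f_ m u| <= g u)%E.
  rewrite /f_ /g abse_EFin lee_fin ger0_norm ?mulr_ge0 ?expR_ge0// mulrC.
  have -> : macdonald_exponent (b / 2) 1 0 u = b / 2 * u - expR u.
    by rewrite /macdonald_exponent; ring.
  rewrite ler_wpM2r ?expR_ge0// ler_expR.
  have := hA (- ln (expR u + (4 * m.+1%:R)^-1)); lra.
have [||_ _ h] := @dominated_convergence _ _ _ leb setT measurableT f_ _ g mf mfoo _ ig _.
- by apply: aeW => u _; exact: f_cvg.
- by apply: aeW => u m _; exact: fle.
have bf : bessel b 1 y \is a fin_num.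
  by apply: macdonald_fin_num => //; [exact: ltW|left|left].
have h' : (fun m : nat => (\int[leb]_u f_ m u)%E) @ \oo --> (fine (bessel b 1 y))%:E.
  by rewrite fineK// besselE; exact: h.
exact: (fine_cvg h').
Unshelve. all: by end_near. Qed.

Lemma continuous_near_sqnorm (K : V -> \bar R) (y : V) (P : \bar R -> Prop) :
  {for y, continuous K} -> (\forall z \near K y, P z) ->
  exists2 rho : R, 0 < rho & forall x : V, sqnorm (x - y) < rho -> P (K x).
Proof.
move=> cK /cK /nbhs_ballP[e /= e0 he].
exists (e ^+ 2); first exact: exprn_gt0.
move=> x xe; apply: he; split => // i j; rewrite (ord1 i).
have : enorm (x - y) < e.
  by rewrite -(@ltr_pXn2r _ 2)// ?nnegrE ?enorm_ge0 ?ltW// enorm_sqr.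
by apply: le_lt_trans; apply: le_trans (norm_coord_le _ j); rewrite !mxE distrC.
Qed.

(** The averages of [K] against Gaussians concentrating at [y] converge to the
    right-hand side by [bessel_kernel_pairing] and [heat_shift_cvg]; by
    continuity of [K] at [y], any real below [K y] is below that limit and any
    real above [K y] is above it. *)
Lemma bessel_kernel_neq0E (b : R) (K : V -> \bar R) (y : V) : (0 < n)%N -> 0 < b ->
  is_bessel_kernel b K -> y != 0 ->
  K y = ((bessel_const b)%:E * bessel b 1 y)%E.
Proof.
move=> n0 b0 hK y0.
have q0 : 0 < sqnorm y / 4 by rewrite divr_gt0// -enorm_sqr exprn_gt0// enorm_gt0.
have bf : bessel b 1 y \is a fin_num.
  by apply: macdonald_fin_num => //; [exact: ltW|left|left].
have [cK _ _] := hK.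
have mK := continuous_ereal_measurable cK.
rewrite -(fineK bf) -EFinM; set B := (X in X%:E).
pose Ninf := [set x : V | ~~ (K x \is a fin_num)].
have mNinf : measurable Ninf.
  have -> : Ninf = K @^-1` [set +oo%E] `|` K @^-1` [set -oo%E].
    apply/seteqP; split => x; rewrite /Ninf /=; case: (K x) => [r||] //=.
    - by left.
    - by right.
    - by case.
  apply: measurableU.
    by rewrite -[X in measurable X]setTI; apply: mK => //; exact: emeasurable_set1.
  by rewrite -[X in measurable X]setTI; apply: mK => //; exact: emeasurable_set1.
have mfK : measurable_fun setT (fun x => fine (K x)) by exact: measurableT_comp.
(* the pairings see [K] through [fine] and ignore the null set [Ninf]; the value
   [M] of [g] there keeps the comparison of [g] with [M] true near [y] *)
pose g (M : R) (x : V) : R := fine (K x) + M * \1_Ninf x.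
have mg M : measurable_fun setT (g M).
  by apply: measurable_funD => //; apply: measurable_funM => //; exact: measurable_indic.
have aeg M c : 0 < c -> ae_eq (lebd n) setT (fun x => K x * (gaussd c y x)%:E)%E
    (fun x => (g M x * gaussd c y x)%:E).
  move=> c0; have := integrable_ae measurableT (bessel_kernel_integrable y c0 hK).
  apply: filterS => x /= /(_ I) h _.
  have Kf : K x \is a fin_num.
    move: h; case: (K x) => // h.
      by rewrite gt0_mulye ?lte_fin ?expR_gt0 in h.
    by rewrite gt0_mulNye ?lte_fin ?expR_gt0 in h.
  by rewrite /g indicE memNset/= /Ninf /= ?Kf// mulr0 addr0 EFinM fineK.
have ig M c : 0 < c -> (lebd n).-integrable setT (fun x => (g M x * gaussd c y x)%:E).
  move=> c0; have mgc : measurable_fun setT (fun x : V => (gaussd c y x)%:E).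
    by apply: measurableT_comp => //; exact: measurable_gaussd.
  have mgg : measurable_fun setT (fun x => (g M x * gaussd c y x)%:E).
    by apply: measurableT_comp => //; apply: measurable_funM => //; exact: measurable_gaussd.
  have /integrableP[_] := bessel_kernel_integrable y c0 hK.
  move=> hint; apply/integrableP; split => //; move: hint; congr (_ < _)%E.
  apply: ae_eq_integral => //.
  - by apply: measurableT_comp => //; exact: emeasurable_funM.
  - exact: measurableT_comp.
  by apply: filterS (aeg M c c0) => x h /h /= ->.
have Ig M c : 0 < c -> Rintegral (lebd n) setT (fun x => g M x * gaussd c y x) =
    Rintegral (lebd n) setT (fun x => fine (K x) * gaussd c y x).
  move=> c0; rewrite /Rintegral; congr fine.
  have mgM (M' : R) : measurable_fun setT (fun x => (g M' x * gaussd c y x)%:E).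
    by apply: measurableT_comp => //; apply: measurable_funM => //; exact: measurable_gaussd.
  transitivity (\int[lebd n]_x (g 0 x * gaussd c y x)%:E)%E.
    apply: ae_eq_integral => //.
    apply: ae_eq_trans (aeg 0 c c0); exact/ae_eq_sym/aeg.
  by apply: eq_integral => x _; rewrite /g mul0r addr0.
have lim M : (fun m : nat => @gauss_peak R n m.+1%:R *
     Rintegral (lebd n) setT (fun x => g M x * gaussd m.+1%:R y x)) @ \oo --> B.
  have hl : (fun m : nat => bessel_const b * Rintegral leb setT (fun u =>
     expR (b / 2 * u - expR u) * heat (ln (expR u + (4 * m.+1%:R)^-1)) y)) @ \oo --> B.
    by apply: cvgM; [exact: cvg_cst|exact: heat_shift_cvg].
  apply: cvg_trans hl; apply: near_eq_cvg; near=> m.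
  by rewrite Ig ?ltr0Sn// (bessel_kernel_pairing y b0 _ hK) ?ltr0Sn.
have lower M : (M%:E < K y)%E -> M <= B.
  move=> hM; have [|rho rho0 hrho] := @continuous_near_sqnorm K y (fun z => M%:E < z)%E (cK y).
    by apply: (@open_nbhs_nbhs _ _ [set z | M%:E < z]%E); split => //; exact: open_ereal_gt_ereal.
  apply: (gauss_limit_ge rho0 (mg M) (fun c => ig M c) _ (lim M)) => x xr.
  have := hrho x xr; rewrite /g indicE.
  case: (boolP (x \in Ninf)) => [|xN].
    rewrite inE /Ninf /=; case: (K x) => //= _ _; rewrite mulr1 add0r//.
  have : K x \is a fin_num.
    by apply: contraNT xN => h; rewrite inE.
  by rewrite mulr0 addr0; case: (K x) => // r _ /=; rewrite lte_fin => /ltW.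
have upper M : (K y < M%:E)%E -> B <= M.
  move=> hM; have [|rho rho0 hrho] := @continuous_near_sqnorm K y (fun z => z < M%:E)%E (cK y).
    by apply: (@open_nbhs_nbhs _ _ [set z | z < M%:E]%E); split => //; exact: open_ereal_lt_ereal.
  rewrite -lerN2.
  apply: (@gauss_limit_ge R n (fun x => - g M x) y (- M) (- B) rho rho0).
  - exact: measurableT_comp.
  - move=> c c0; have := integrableN (ig M c c0).
    by apply: eq_integrable => // x _ /=; rewrite mulNr.
  - move=> x xr; rewrite lerN2; have := hrho x xr; rewrite /g indicE.
    case: (boolP (x \in Ninf)) => [|xN].
      by rewrite inE /Ninf /=; case: (K x) => //= _ _; rewrite mulr1 add0r.
    have : K x \is a fin_num.
      by apply: contraNT xN => h; rewrite inE.
    by rewrite mulr0 addr0; case: (K x) => // r _ /=; rewrite lte_fin => /ltW.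
  - have limN : (fun m : nat => - (@gauss_peak R n m.+1%:R *
        Rintegral (lebd n) setT (fun x => g M x * gaussd m.+1%:R y x))) @ \oo --> - B.
      by apply: cvgN; exact: lim.
    apply: cvg_trans limN; apply: near_eq_cvg; near=> m.
    rewrite /= -mulrN; congr (_ * _).
    rewrite -[LHS]mulN1r -RintegralZl//; last exact: ig.
    by apply: eq_Rintegral => x _; rewrite mulN1r mulNr.
move: lower upper; case: (K y) => [r| |] lower upper.
- congr EFin; apply/eqP; rewrite eq_le; apply/andP; split.
    by apply/ler_addgt0Pr => e e0; rewrite -lerBlDr; apply: lower; rewrite lte_fin; lra.
  by apply/ler_addgt0Pr => e e0; apply: upper; rewrite lte_fin; lra.
- by exfalso; have := lower (B + 1); rewrite ltry => /(_ isT); lra.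
- by exfalso; have := upper (B - 1); rewrite ltNyr => /(_ isT); lra.
Unshelve. all: by end_near. Qed.

End kernel.

(** * Powers of the Bessel kernel *)

Section power.
Context {R : realType} {n : nat}.
Local Notation V := 'rV[R]_n.

(** The bound [|x|^(b-n) exp(-(e + 1/4) |x|)], up to a constant factor. *)
Lemma bessel_lower (b : R) (x : V) : b <= n%:R -> x != 0 ->
  ((expR ((b - n%:R) / 2 - 4^-1 + (b - n%:R) * ln (enorm x) -
     (expR 1 + 4^-1) * enorm x))%:E <= bessel b 1 x)%E.
Proof.
move=> bn x0; have r0 := enorm_gt0 x0.
have p0 : (b - n%:R) / 2 <= 0 by rewrite pmulr_lle0// subr_le0.
rewrite bessel_enormE; apply: le_trans (macdonald_neg_ge p0 (@ler01 R) r0).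
by rewrite lee_fin ler_expR; lra.
Qed.

(** Away from the origin [K] is known and exceeds a multiple of [|x|^(b-n)] on
    the unit ball; were [K 0] below some real [A], continuity would bound [K]
    by [A] at a point [x] arbitrarily close to the origin. *)
Lemma bessel_kernel0 (b : R) (K : V -> \bar R) : (0 < n)%N -> 0 < b -> b < n%:R ->
  is_bessel_kernel b K -> K 0 = +oo%E.
Proof.
move=> n0 b0 bn hK; have [cK _ _] := hK; apply/eqyP => A A0.
rewrite leNgt; apply/negP => KA.
have [|rho rho0 hrho] := @continuous_near_sqnorm R n K 0 (fun z => z < A%:E)%E (cK 0).
  by apply: (@open_nbhs_nbhs _ _ [set z | z < A%:E]%E); split => //; exact: open_ereal_lt_ereal.
have k0 := @bessel_const_gt0 R n b b0.
set k := bessel_const b in k0.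
pose c := expR ((b - n%:R) / 2 - 4^-1 - (expR 1 + 4^-1)).
have D0 : 0 < k * c * (n%:R - b).
  by apply: mulr_gt0; rewrite ?subr_gt0// mulr_gt0 ?expR_gt0.
(* the test point has norm [expR (- s)]: the first term puts it in the ball,
   the second makes the kernel exceed [A] there since [expR z >= z] *)
pose s := `|ln rho| + A / (k * c * (n%:R - b)) + 1.
have a0 : 0 <= A / (k * c * (n%:R - b)) by rewrite divr_ge0// ltW.
have s0 : 0 <= s by have := normr_ge0 (ln rho); rewrite /s; lra.
pose t := expR (- s).
pose i0 := Ordinal n0.
pose x : V := t *: delta_mx ord0 i0.
have t0 : 0 < t by exact: expR_gt0.
have t1 : t <= 1 by rewrite -expR0 ler_expR oppr_le0.
have sx : sqnorm x = t ^+ 2.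
  have := sqnorm_line t (delta_mx ord0 i0 : V) 0.
  have s00 : sqnorm (0 : V) = 0 by apply: big1 => i _; rewrite mxE mul0r.
  rewrite addr0 => ->; rewrite [sqnorm (delta_mx _ _)]dotp_delta dotp_delta s00.
  by rewrite !mxE !eqxx mulr1 mulr0 !addr0.
have ex : enorm x = t.
  by rewrite /enorm -/(sqnorm x) sx sqrtr_sqr ger0_norm ?ltW.
have x0 : x != 0 by rewrite -enorm_eq0 ex gt_eqF.
have := hrho x; rewrite subr0 sx (bessel_kernel_neq0E n0 b0 hK x0) -/k.
have tr : t ^+ 2 < rho.
  rewrite -expRM_natl -[X in _ < X]lnK ?posrE// ltr_expR.
  have := ler_norm (- ln rho); rewrite normrN /s; have := normr_ge0 (ln rho); lra.
move=> /(_ tr); apply/negP; rewrite -leNgt.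
apply: (@le_trans _ _ (k%:E * (c * expR ((n%:R - b) * s))%:E)%E).
  rewrite -EFinM lee_fin mulrA.
  apply: (@le_trans _ _ (k * c * ((n%:R - b) * s))); last first.
    have kc0 : 0 < k * c by rewrite mulr_gt0 ?expR_gt0.
    rewrite ler_pM2l//.
    by apply: le_trans (expR_ge1Dx _); rewrite lerDr.
  rewrite mulrA -ler_pdivrMl// mulrC.
  by have := normr_ge0 (ln rho); rewrite /s; lra.
rewrite lee_pmul2l//; apply: le_trans (bessel_lower (ltW bn) x0).
rewrite ex lee_fin -expRD ler_expR expRK.
have : (expR 1 + 4^-1) * t <= expR 1 + 4^-1.
  by rewrite ler_piMr// addr_ge0 ?expR_ge0.
lra.
Qed.

Lemma bessel_kernelE (b : R) (K : V -> \bar R) (x : V) : (0 < n)%N -> 0 < b -> b < n%:R ->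
  is_bessel_kernel b K -> K x = ((@bessel_const R n b)%:E * bessel b 1 x)%E.
Proof.
move=> n0 b0 bn hK; have [->|x0] := eqVneq x 0; last exact: bessel_kernel_neq0E.
rewrite (bessel_kernel0 n0 b0 bn hK) bessel0 ?(ltW bn)//.
by rewrite gt0_muley// lte_fin bessel_const_gt0.
Qed.

(** Both kernels are comparable with a power of [|x|] up to exponential
    factors, and [r (b - n) = a - n] matches the powers. The mass is then chosen
    large for the lower bound and small for the upper bound, so that the
    exponential factors compare in the right direction. *)
Lemma bessel_power_bounds (b k r : R) : 0 < b -> b < n%:R -> 0 < k -> 1 <= r ->
  let a := n%:R - r * (n%:R - b) in
  exists m1 k2 c1 c2 : R, [/\ 0 < m1, 0 < k2, 0 < c1, 0 < c2 &
    forall x : V, (c1%:E * bessel a m1 x <= poweR (k%:E * bessel b 1 x) r)%E /\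
      (poweR (k%:E * bessel b 1 x) r <= c2%:E * bessel a (k2 ^+ 2) x)%E].
Proof.
move=> b0 bn k0 r1 a.
have r0 : 0 < r by lra.
have p0 : (b - n%:R) / 2 < 0 by rewrite pmulr_llt0// subr_lt0.
have aE : (a - n%:R) = r * (b - n%:R) by rewrite /a; ring.
have an : a < n%:R by rewrite -subr_lt0 aE pmulr_rlt0// subr_lt0.
have q0 : (a - n%:R) / 2 < 0 by rewrite pmulr_llt0// subr_lt0.
have fin8 (p : R) : p < 0 -> 0 < fine (macdonald p 0 (8^-1 : R)) /\
    macdonald p 0 (8^-1 : R) \is a fin_num.
  move=> h; have f : macdonald p 0 (8^-1 : R) \is a fin_num.
    by apply: macdonald_fin_num; [|rewrite invr_ge0|right|left].
  by split => //; rewrite fine_gt0// macdonald_gt0 ?invr_ge0//= ltey_eq f.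
have [M0 Mf] := fin8 _ p0; have [M0' Mf'] := fin8 _ q0.
set M := fine _ in M0; set M' := fine _ in M0'.
pose w := expR 1 + 4^-1 : R.
have w0 : 0 < w by rewrite addr_gt0 ?expR_gt0.
(* [bessel a (k1^2)] decays at the rate [k1 / 2], here the rate [r w] of the
   [r]-th power of the lower bound *)
pose k1 := 2 * r * w.
(* [k2^2 e = 1/4], so [bessel a (k2^2)] is bounded below with the rate
   [1/4 + 1/4 <= r / 2], the rate of the [r]-th power of the upper bound *)
pose k2 := expR (- 2^-1) / 2 : R.
have k2e : k2 ^+ 2 * expR 1 = 4^-1.
  transitivity (expR (- 2^-1) * expR (- 2^-1) * expR 1 / 4 : R); first by rewrite /k2; field.
  rewrite -!expRD.
  have -> : - 2^-1 - 2^-1 + 1 = 0 :> R by field.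
  by rewrite expR0 mul1r.
exists (k1 ^+ 2), k2, (k `^ r * expR (r * ((b - n%:R) / 2 - 4^-1)) / M'),
  ((k * M) `^ r * expR (4^-1 - r * ((b - n%:R) / 2) + 4^-1)).
have kr0 : 0 < k `^ r by exact: powR_gt0.
split.
- by rewrite exprn_gt0// !mulr_gt0.
- by rewrite divr_gt0 ?expR_gt0.
- by rewrite divr_gt0// mulr_gt0 ?expR_gt0.
- by rewrite mulr_gt0 ?expR_gt0// powR_gt0// mulr_gt0.
move=> x; have [->|x0] := eqVneq x 0.
  rewrite !bessel0 ?(ltW bn) ?(ltW an) ?sqr_ge0// !gt0_muley ?lte_fin//.
  - by rewrite poweRyr ?gt_eqF.
  - by rewrite mulr_gt0 ?expR_gt0// powR_gt0// mulr_gt0.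
  - by rewrite divr_gt0// mulr_gt0 ?expR_gt0.
have rho0 := enorm_gt0 x0; set rho := enorm x in rho0.
have q8 : 0 < sqnorm x / 4 by rewrite divr_gt0// -enorm_sqr exprn_gt0.
have Bf : bessel b 1 x \is a fin_num.
  by apply: macdonald_fin_num => //; [exact: ltW|left|left].
have B0 : 0 <= fine (bessel b 1 x) by rewrite fine_ge0// bessel_ge0.
have lowB := bessel_lower (ltW bn) x0.
have uppB := @macdonald_neg_le R ((b - n%:R) / 2) 1 rho rho0.
rewrite expr1n -bessel_enormE -(fineK Bf) -(fineK Mf) -EFinM lee_fin -/M mul1r in uppB.
rewrite -(fineK Bf) lee_fin -/rho -/w in lowB.
rewrite -(fineK Bf) -EFinM poweR_EFin.
set B := fine (bessel b 1 x) in B0 lowB uppB *.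
split.
- have h := @macdonald_neg_le R ((a - n%:R) / 2) k1 rho rho0.
  rewrite -bessel_enormE in h.
  apply: (@le_trans _ _ ((k `^ r * expR (r * ((b - n%:R) / 2 - 4^-1)) / M')%:E *
     ((expR (2 * ((a - n%:R) / 2) * ln rho - k1 * rho / 2))%:E * M'%:E))%E).
    rewrite lee_pmul2l//; last by rewrite lte_fin divr_gt0// mulr_gt0 ?expR_gt0.
    by rewrite /M' (fineK Mf').
  rewrite -!EFinM lee_fin [X in X <= _](_ : _ = k `^ r *
    (expR (r * ((b - n%:R) / 2 - 4^-1)) * expR (2 * ((a - n%:R) / 2) * ln rho - k1 * rho / 2))); last first.
    by field; rewrite gt_eqF.
  rewrite powRM ?(ltW k0)// ler_pM2l// -expRD.
  apply: le_trans (ge0_ler_powR (ltW r0) _ _ lowB); rewrite ?nnegrE ?expR_ge0//.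
  rewrite -expRM ler_expR le_eqVlt; apply/orP; left; apply/eqP.
  by rewrite aE /k1; field.
- have h := @macdonald_neg_ge R ((a - n%:R) / 2) (k2 ^+ 2) rho (ltW q0) (sqr_ge0 _) rho0.
  rewrite -bessel_enormE k2e in h.
  apply: (@le_trans _ _ (((k * M) `^ r * expR (4^-1 - r * ((b - n%:R) / 2) + 4^-1))%:E *
     (expR ((a - n%:R) / 2 + 2 * ((a - n%:R) / 2) * ln rho - 4^-1 * rho - (1 + rho) / 4))%:E)%E); last first.
    rewrite lee_pmul2l// lte_fin.
    by rewrite mulr_gt0 ?expR_gt0// powR_gt0// mulr_gt0.
  rewrite -EFinM lee_fin -[leRHS]mulrA -expRD.
  have : (k * B) `^ r <= (k * (expR (2 * ((b - n%:R) / 2) * ln rho - rho / 2) * M)) `^ r.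
    apply: ge0_ler_powR; rewrite ?(ltW r0)//.
    - by rewrite nnegrE mulr_ge0 ?(ltW k0).
    - by rewrite nnegrE !mulr_ge0 ?expR_ge0 ?(ltW k0) ?(ltW M0).
    - by rewrite ler_pM2l.
  move=> /le_trans; apply.
  rewrite mulrCA [X in X <= _]powRM ?expR_ge0 ?mulr_ge0 ?(ltW k0) ?(ltW M0)// mulrC.
  rewrite ler_wpM2l ?powR_ge0// -expRM ler_expR aE.
  have : rho <= r * rho by rewrite ler_peMl// ltW.
  lra.
Qed.

End power.

Theorem proposition1p7 (R : realType) (d : nat) (delta0 gamma r : R)
    (mu : {measure set 'rV[R]_d -> \bar R}) (K : 'rV[R]_d -> \bar R)
    (d_ge1 : (1 <= d)%N)
    (delta0_bounds : 0 < delta0 <= 1)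
    (gamma_bounds : 0 < gamma < 1)
    (r_bounds : 1 <= r < d%:R / (d%:R - delta0 * (1 - gamma)))
    (mu_tempered : tempered mu)
    (mu_nonneg_definite : nonneg_definite mu)
    (K_bessel : is_bessel_kernel (delta0 * (1 - gamma)) K) :
  let alpha := alpha_exponent d delta0 gamma r in
  let Kr : 'rV[R]_d -> \bar R := fun x => poweR (K x) r in
  0 < alpha < d%:R /\
  (singularity_condition alpha mu <->
   mu.-integrable setT (econv Kr Kr)) /\
  (mu.-integrable setT (econv Kr Kr) <->
   mu.-integrable (@unit_ball R d) (econv Kr Kr)).
Proof.
move=> alpha Kr.
set b := delta0 * (1 - gamma) in r_bounds K_bessel *.
have [d0 d1] := andP delta0_bounds; have [g0 g1] := andP gamma_bounds.
have b0 : 0 < b by rewrite mulr_gt0// subr_gt0.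
have b1 : b < 1 by rewrite /b; nra.
have dR : 1 <= d%:R :> R by rewrite ler1n.
have bd : b < d%:R by exact: lt_le_trans b1 dR.
have [r1 r2] := andP r_bounds.
have db0 : 0 < d%:R - b by rewrite subr_gt0.
rewrite ltr_pdivlMr// in r2.
have r0 : 0 < r by lra.
have alpha0 : 0 < alpha by rewrite /alpha /alpha_exponent subr_gt0.
split.
  by rewrite alpha0 /alpha /alpha_exponent gtrDl oppr_lt0 mulr_gt0.
have [m1 [k2 [c1 [c2 [m10 k20 c10 c20 bounds]]]]] :=
  @bessel_power_bounds R d b (@bessel_const R d b) r b0 bd (bessel_const_gt0 b0) r1.
have KE x := bessel_kernelE x d_ge1 b0 bd K_bessel.
have mKr : measurable_fun setT Kr.
  have [cK _ _] := K_bessel.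
  apply: (measurableT_comp (measurable_poweR r)).
  exact: continuous_ereal_measurable.
have Kr0 x : (0 <= Kr x)%E by exact: poweR_ge0.
have [||C1 [C2 [C10 C20 h1 h2]]] := @econv_bessel_bounds R d alpha m1 (k2 ^+ 2) c1 c2 Kr
    alpha0 c10 c20 mKr Kr0 _ _.
- by move=> x; rewrite /Kr KE; exact: (bounds x).1.
- by move=> x; rewrite /Kr KE; exact: (bounds x).2.
apply: (bessel_comparable_equiv mu_tempered alpha0 m10 k20 C10 C20 _ _ h1 h2).
  exact: measurable_econv.
by move=> x; exact: econv_ge0.
Qed.
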